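(* Suppose conditions (i)-(iii) of the context hold. Consider the disturbed error system $$\dot{\tilde x}^{\mathrm d}(t)=-\bar\Gamma\bar\Lambda^\top(t)\bar\Lambda(t)\tilde x^{\mathrm d}(t)+\big(\bar\Gamma\bar\Lambda^\top(t)\bar\Delta_2-\bar\Delta_1\big)\delta(t)$$ with input $\delta(t)\in\mathbb R^r$ and performance output $z(t)=Q\tilde x^{\mathrm d}(t)+W\delta(t)\in\mathbb R^p$, where $W^\top W=I_r$ and $Q^\top W=0$. Choose $\alpha>0$ as $$\underset{\alpha\in\mathbb R_{>0}}{\mathrm{arg\,max}}\ \frac{\underline\iota_3(\alpha)}{\bar\iota_3(\alpha)},$$ with $\underline\iota_3$ and $\bar\iota_3$ the explicit quantities defined in the context. Choose $c_2>0$ such that $$\begin{bmatrix}\frac{c_2\underline\iota_3}{2}I_{nN}&-Q^\top\\-Q&I_p\end{bmatrix}>0 .$$ Solve the following semidefinite program in the scalar decision variables $c_1,\gamma_1,\gamma_2,\gamma$ (with $c_1,\gamma_1,\gamma_2>0$): $$\text{minimize }\gamma\quad\text{subject to}\quad\gamma>0,\quad\gamma_1-\gamma_2\ge0,\quad\begin{bmatrix}\Phi_{11}&\Phi_{12}\\ \Phi_{12}^\top&-\gamma_2I_{nN}\end{bmatrix}\le0,$$ with $\Phi_{11},\Phi_{12}$ as in the context. If this program is feasible, choose $\bar\Gamma$ such that $\sqrt{\gamma_1}I_{nN}\ge\bar\Gamma\ge\sqrt{\gamma_2}I_{nN}$. In such case, the disturbed error system with input $\delta$ and output $z$ has an $\mathcal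 L_2$-gain of at most $\sqrt\gamma$.
   Context: Setting. There are $n$ agents with an undirected time-dependent communication graph on $\{1,\dots,n\}$ with $n_e(t)$ edges; $D(t)\in\mathbb R^{n\times n_e(t)}$ is an oriented incidence matrix ($+1$ at the source, $-1$ at the sink of each edge, $0$ otherwise) and $L(t)=D(t)D^\top(t)$ is the Laplacian. Agent $i$ has a regressor $C_i(t)\in\mathbb R^{N_y\times N}$; $\bar C(t)=\mathrm{diag}(C_1(t),\dots,C_n(t))$ (block diagonal) and $$\bar\Lambda(t)=\begin{bmatrix}\bar C(t)\\ \sqrt\alpha\,D^\top(t)\otimes I_N\end{bmatrix},$$ with $\alpha>0$ the consensus gain and $\bar\Gamma=\mathrm{diag}(\Gamma_1,\dots,\Gamma_n)$, $\Gamma_i\in\mathbb R^{N\times N}$ symmetric, the gradient descent gain. The disturbance enters as $\dot\theta^{\mathrm d}=\Delta_1\delta$ with $\Delta_1\in\mathbb R^{N\times r}$, $x^{\mathrm d}=\mathbf 1_n\otimes\theta^{\mathrm d}$, $\bar\Delta_1=\mathbf 1_n\otimes\Delta_1$, $y^{\mathrm d}=\bar\Lambda x^{\mathrm d}+\bar\Delta_2\delta$ with $\bar\Delta_2\in\mathbb R^{(nN_y+Nn_e(t))\times r}$; the estimator is $\dot{\hat x}^{\mathrm d}=-\bar\Gamma\bar\Lambda^\top(\bar\Lambda\hat x^{\mathrm d}-y^{\mathrm d})$, and $\tilde x^{\mathrm d}=\hat x^{\mathrm d}-x^{\mathrm d}$. Also $Q\in\mathbb R^{p\times nN}$, $W\in\mathbb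 R^{p\times r}$. $\|\cdot\|$ is the Euclidean norm or the induced matrix norm. Conditions: (i) there are constants $T>0$, $\bar\iota_1\ge\underline\iota_1>0$, independent of $t$, with $\bar\iota_1I_N\ge\int_{t-T}^t\sum_{i=1}^nC_i^\top(s)C_i(s)\,\mathrm ds\ge\underline\iota_1I_N$ for all $t\ge T$. (ii) $\|C_i^\top(t)C_i(t)\|\le r_2$ for all $t\ge0$ and all $i$, with $r_2>0$. (iii) $\int_{t-T}^tL(s)\,\mathrm ds$, with the same $T$, has only one zero eigenvalue, and all remaining eigenvalues are bounded below by a constant $\underline\lambda>0$; and $\|L(t)\|\le r_3$ for all $t\ge0$, with $r_3>0$. Constants (depending on $\alpha$ and on $\bar\Gamma$ through $r_1$). $r_1=\|\bar\Gamma\|$, $r_4=r_2+\alpha r_3$, $$\bar\iota_2=Tr_4,\qquad \underline\iota_2=\min_{a\in\mathbb R^N,\ \|a\|^2\le1}\max\Big\{\alpha\underline\lambda(1-\|a\|^2),\ \frac{\underline\iota_1}{n}\|a\|^2-2r_2T\sqrt{\|a\|^2(1-\|a\|^2)}\Big\},$$ $$\varphi_1=\tfrac12r_1^2\bar\iota_2^2,\qquad \varphi_2=\tfrac14\big(\mathrm e^{2r_1\bar\iota_2}-1\big)-\tfrac12r_1\bar\iota_2,$$ $$\bar\iota_3=\Big(\sqrt{\bar\iota_2-\underline\iota_2+\varphi_2\underline\iota_2}+\sqrt{\bar\iota_2}\Big)^2,\qquad \underline\iota_3=\begin{cases}\left(\dfrac{\sqrt{\bar\iota_2-\underline\iota_2+\varphi_1\underline\iota_2}-\sqrt{\bar\iota_2}}{\varphi_1-1}\right)^2&\text{if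 }\varphi_1\ne1,\\[2mm] \dfrac{\underline\iota_2}{4\bar\iota_2}&\text{if }\varphi_1=1.\end{cases}$$ Matrices (block sizes $nN_y+Nn_e(t)$, $nN$, $p$, $r$): $$\Phi_{11}=\begin{bmatrix}\phi_{11}&0&0&0\\0&-\frac{c_2\underline\iota_3}{2}I_{nN}&Q^\top&0\\0&Q&-I_p&W\\0&0&W^\top&\phi_{44}\end{bmatrix},\qquad \Phi_{12}=\begin{bmatrix}0\\0\\0\\-\frac{2c_1}{\sqrt{c_2\underline\iota_3}}\bar\Delta_1^\top\end{bmatrix},$$ $$\phi_{11}=(-c_1+c_2T)I_{nN_y+Nn_e(t)},\qquad \phi_{44}=\frac{8c_2\bar\iota_3^2}{\underline\iota_3}\bar\Delta_1^\top\bar\Delta_1+\Big(c_1+\frac{8c_2\bar\iota_3^2r_4\gamma_1}{\underline\iota_3}\Big)\bar\Delta_2^\top\bar\Delta_2-\gamma I_r.$$ $\mathcal L_2$-gain: with $\|u\|_{\mathcal L_2}^2=\int_0^\infty u^\top(s)u(s)\,\mathrm ds$, a system $H$ mapping $\mathcal L_2$ inputs to $\mathcal L_2$ outputs has finite $\mathcal L_2$-gain if there are constants $g,b\ge0$ with $\|H(u)\|_{\mathcal L_2}\le g\|u\|_{\mathcal L_2}+b$ for all $u\in\mathcal L_2$; its $\mathcal L_2$-gain is the infimum of the $g$ for which such a $b$ exists.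
   Formalization: In the case φ₁ = 1 the lower constant ι₃ is taken to be ι₂²/(4 ι̅₂), with ι₂ the lower constant (the limit of the other branch), instead of the printed ι₂/(4 ι̅₂), for which the gain bound fails. *)

(* Defs.v *)
From mathcomp Require Import all_boot all_order all_algebra.
From mathcomp Require Import all_classical all_reals all_analysis.
From mathcomp Require Export mxtens.

Set Implicit Arguments.
Unset Strict Implicit.
Unset Printing Implicit Defensive.
Import Order.TTheory GRing.Theory Num.Theory.
Local Open Scope classical_set_scope.
Local Open Scope ring_scope.

Definition sqnorm (R : realType) (m : nat) (v : 'cV[R]_m) : R :=
  \sum_i v i 0 ^+ 2.

Definition enorm (R : realType) (m : nat) (v : 'cV[R]_m) : R :=
  Num.sqrt (sqnorm v).

Definition opnorm (R : realType) (m k : nat) (A : 'M[R]_(m, k)) : R :=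
  sup [set enorm (A *m v) | v in [set v : 'cV[R]_k | enorm v <= 1]].

(* Loewner order; only ever applied to symmetric matrices. *)
Definition mxle (R : realType) (m : nat) (A B : 'M[R]_m) : Prop :=
  forall v : 'cV[R]_m, 0 <= (v^T *m (B - A) *m v) 0 0.

Definition mxlt (R : realType) (m : nat) (A B : 'M[R]_m) : Prop :=
  forall v : 'cV[R]_m, v != 0 -> 0 < (v^T *m (B - A) *m v) 0 0.

Definition mxint (R : realType) (m k : nat) (D : set R)
    (F : R -> 'M[R]_(m, k)) : 'M[R]_(m, k) :=
  \matrix_(i, j) \int[lebesgue_measure]_(s in D) F s i j.

Definition simple_graph (n : nat) (g : rel 'I_n) : Prop :=
  symmetric g /\ irreflexive g.

(* The columns of D enumerate the edges of g, each exactly once, with an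
   arbitrary orientation; in particular ne is the number of edges of g. *)
Definition oriented_incidence (R : realType) (n ne : nat) (g : rel 'I_n)
    (D : 'M[R]_(n, ne)) : Prop :=
  exists src snk : 'I_ne -> 'I_n,
    [/\ forall k, g (src k) (snk k),
        forall i j, g i j -> exists! k : 'I_ne,
          (src k = i /\ snk k = j) \/ (src k = j /\ snk k = i)
      & forall i k, D i k = (i == src k)%:R - (i == snk k)%:R].

Definition laplacian (R : realType) (n ne : nat) (D : 'M[R]_(n, ne)) :
  'M[R]_n := D *m D^T.

Definition blockdiag (R : realType) (n p q : nat)
    (A : 'I_n -> 'M[R]_(p, q)) : 'M[R]_(n * p, n * q) :=
  \sum_i delta_mx i i *t A i.

(* 1_n (x) A; the cast only turns the width 1 * q into q. *)
Definition ones_tens (R : realType) (n p q : nat) (A : 'M[R]_(p, q)) :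
  'M[R]_(n * p, q) :=
  castmx (erefl (n * p)%N, mul1n q) ((const_mx 1 : 'cV[R]_n) *t A).

Definition Lambda (R : realType) (n ne Ny N : nat) (alpha : R)
    (C : 'I_n -> 'M[R]_(Ny, N)) (D : 'M[R]_(n, ne)) :
  'M[R]_(n * Ny + ne * N, n * N) :=
  col_mx (blockdiag C) (Num.sqrt alpha *: (D^T *t (1%:M : 'M[R]_N))).

Definition r4 (R : realType) (r2 r3 alpha : R) : R := r2 + alpha * r3.

Definition iota2_hi (R : realType) (T r2 r3 alpha : R) : R :=
  T * r4 r2 r3 alpha.

Definition iota2_lo (R : realType) (n N : nat) (T r2 iota1_lo lambda_lo : R)
    (alpha : R) : R :=
  inf [set Num.max (alpha * lambda_lo * (1 - sqnorm a))
             (iota1_lo / n%:R * sqnorm a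
              - 2 * r2 * T * Num.sqrt (sqnorm a * (1 - sqnorm a)))
      | a in [set a : 'cV[R]_N | sqnorm a <= 1]].

Definition phi1 (R : realType) (r1 i2hi : R) : R := r1 ^+ 2 * i2hi ^+ 2 / 2.

Definition phi2 (R : realType) (r1 i2hi : R) : R :=
  (expR (2 * r1 * i2hi) - 1) / 4 - r1 * i2hi / 2.

Definition iota3_hi (R : realType) (r1 i2hi i2lo : R) : R :=
  (Num.sqrt (i2hi - i2lo + phi2 r1 i2hi * i2lo) + Num.sqrt i2hi) ^+ 2.

(* The value at phi1 = 1 is the limit of the first branch. With
   i2lo / (4 * i2hi) in its place the L2-gain bound fails when i2hi is small. *)
Definition iota3_lo (R : realType) (r1 i2hi i2lo : R) : R :=
  let f1 := phi1 r1 i2hi in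
  if f1 == 1 then i2lo ^+ 2 / (4 * i2hi)
  else ((Num.sqrt (i2hi - i2lo + f1 * i2lo) - Num.sqrt i2hi) / (f1 - 1)) ^+ 2.

Definition argmax_pos (R : realType) (f : R -> R) (a : R) : Prop :=
  0 < a /\ forall b, 0 < b -> f b <= f a.

Definition Phi11 (R : realType) (m k p r : nat) (T i3lo i3hi r4 : R)
    (Delta1 : 'M[R]_(k, r)) (Delta2 : 'M[R]_(m, r))
    (Q : 'M[R]_(p, k)) (W : 'M[R]_(p, r)) (c1 c2 gamma1 gamma : R) :
  'M[R]_(m + (k + (p + r))) :=
  let phi11 := (- c1 + c2 * T)%:M : 'M[R]_m in
  let phi44 := (8 * c2 * i3hi ^+ 2 / i3lo) *: (Delta1^T *m Delta1)
    + (c1 + 8 * c2 * i3hi ^+ 2 * r4 * gamma1 / i3lo) *: (Delta2^T *m Delta2)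
    - gamma%:M in
  block_mx phi11 0 0
    (block_mx (- (c2 * i3lo / 2))%:M (row_mx Q^T 0) (col_mx Q 0)
       (block_mx (- 1)%:M W W^T phi44)).

Definition Phi12 (R : realType) (m k p r : nat) (i3lo : R)
    (Delta1 : 'M[R]_(k, r)) (c1 c2 : R) : 'M[R]_(m + (k + (p + r)), k) :=
  col_mx 0 (col_mx 0 (col_mx 0
    (- (2 * c1 / Num.sqrt (c2 * i3lo)) *: Delta1^T))).

(* Constraints of "minimize gamma" at the point (c1, gamma1, gamma2, gamma); the
   number of rows of Delta2 t varies with the number of edges at time t, and
   the matrix inequality is imposed at all times. *)
Definition sdp_feasible (R : realType) (k p r : nat) (m : R -> nat)
    (T i3lo i3hi r4 : R) (Delta1 : 'M[R]_(k, r))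
    (Delta2 : forall t : R, 'M[R]_(m t, r))
    (Q : 'M[R]_(p, k)) (W : 'M[R]_(p, r)) (c2 : R)
    (c1 gamma1 gamma2 gamma : R) : Prop :=
  [/\ [/\ 0 < c1, 0 < gamma1 & 0 < gamma2], 0 < gamma, 0 <= gamma1 - gamma2
    & forall t, 0 <= t ->
      mxle (block_mx
              (Phi11 T i3lo i3hi r4 Delta1 (Delta2 t) Q W c1 c2 gamma1 gamma)
              (Phi12 (m t) p i3lo Delta1 c1 c2)
              (Phi12 (m t) p i3lo Delta1 c1 c2)^T
              (- gamma2)%:M) 0].

Definition L2 (R : realType) (m : nat) (u : R -> 'cV[R]_m) : Prop :=
  (forall i, measurable_fun (`[0, +oo[ : set R) (fun s => u s i 0)) /\
  (\int[lebesgue_measure]_(s in `[0%R, +oo[) (sqnorm (u s))%:E < +oo)%E.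

Definition L2norm (R : realType) (m : nat) (u : R -> 'cV[R]_m) : R :=
  Num.sqrt (\int[lebesgue_measure]_(s in `[0, +oo[) sqnorm (u s)).

(* A system is given by its input-output pairs. *)
Definition system (R : realType) (r p : nat) : Type :=
  (R -> 'cV[R]_r) -> (R -> 'cV[R]_p) -> Prop.

Definition L2_gain_const (R : realType) (r p : nat) (H : system R r p)
    (g : R) : Prop :=
  0 <= g /\ exists2 b : R, 0 <= b &
    forall u y, L2 u -> H u y -> L2 y /\ L2norm y <= g * L2norm u + b.

(* +oo when the gain is not finite *)
Definition L2_gain (R : realType) (r p : nat) (H : system R r p) : \bar R :=
  ereal_inf [set g%:E | g in [set g | L2_gain_const H g]].

(* Caratheodory solutions on [0, +oo[ of dx/dt = F(t) x + G(t) delta,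
   x(0) = x0, in integral form. *)
Definition solution (R : realType) (k r : nat) (F : R -> 'M[R]_k)
    (G : R -> 'M[R]_(k, r)) (x0 : 'cV[R]_k) (delta : R -> 'cV[R]_r)
    (x : R -> 'cV[R]_k) : Prop :=
  let rhs s := F s *m x s + G s *m delta s in
  forall t, 0 <= t ->
    (forall i, lebesgue_measure.-integrable `[0, t]
                 (fun s => (rhs s i 0)%:E)) /\
    x t = x0 + mxint `[0, t] rhs.

Definition error_system (R : realType) (k p r : nat) (m : R -> nat)
    (Gam : 'M[R]_k) (Lam : forall t : R, 'M[R]_(m t, k))
    (Delta1 : 'M[R]_(k, r)) (Delta2 : forall t : R, 'M[R]_(m t, r))
    (Q : 'M[R]_(p, k)) (W : 'M[R]_(p, r)) (x0 : 'cV[R]_k) : system R r p :=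
  fun delta z => exists2 x,
    solution (fun t => - (Gam *m (Lam t)^T *m Lam t))
             (fun t => Gam *m (Lam t)^T *m Delta2 t - Delta1) x0 delta x
    & forall t, 0 <= t -> z t = Q *m x t + W *m delta t.

(* Main.v *)
Require Import Defs.
From mathcomp Require Import all_boot all_order all_algebra.
From mathcomp Require Import all_classical all_reals all_analysis.
From mathcomp Require Import measurable_realfun.
From mathcomp Require Import ring lra.
Set Implicit Arguments.
Unset Strict Implicit.
Unset Printing Implicit Defensive.
Import Order.TTheory GRing.Theory Num.Theory.
Import numFieldNormedType.Exports.
Local Open Scope classical_set_scope.
Local Open Scope ring_scope.

(** Why the gain bound holds.

    Write M(t) for the Gram matrix of the stacked regressor Lambda(t), whose size
    does not depend on the number of edges, e = Lambda x - Delta2 delta,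
    f = Lambda^T e and w = Delta1 delta, so that x' = - Gam f - w. Let l, h and l3
    be the constants iota2_lo, iota2_hi and iota3_lo, and let V = x^T Gam^-1 x.

    Energy. Along a solution, V' = - 2 (Lambda x) . e - 2 x . Gam^-1 w, and
    2 (Lambda x) . e = |Lambda x|^2 + |e|^2 - |Delta2 delta|^2. So V dissipates both
    |Lambda x|^2 and |e|^2, hence |f|^2 / r4, up to the disturbance and up to a cross
    term that Young's inequality bounds by l3 / (2 T) |x|^2 plus a multiple of
    |Delta1 delta|^2.

    Excitation. Splitting a vector into the mean of the agents and the deviations
    from it, the regressors excite the mean and the Laplacian excites the
    deviations, by its spectral gap: the integral of M over every window
    [t, t + T] is at least l (network_excitation). Replacing x(t) by x(s) inside
    the window costs the integral of Gam f + w over [t, s]; with the weights of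
    iota3_lo_weights one gets l3 |x(t)|^2 <= integral over [t, t + T] of H, where
    H = |Lambda x|^2 + |f|^2 / r4 + K |w|^2 (excitation_window). Windows that look
    forward are used because they cover every t >= 0 and count every instant at
    most T times; an initial interval would otherwise spoil the constant.

    Closing the loop. Integrating over t, the integral X of |x|^2 satisfies
    l3 X <= T (integral of H) <= T (V(0) + disturbance) + l3 X / 2, provided that X
    is finite, which follows from the bound on V itself (dissipation_state_bound).

    Gain. The matrix inequality says c2 T <= c1 and bounds
    |delta|^2 + c1 |Delta2 delta|^2 + 4 c1^2 / (c2 l3 gamma2) |Delta1 delta|^2 by
    gamma |delta|^2 (lmi_weight, lmi_disturbance); the choice of c2 gives
    |Q x|^2 <= c2 l3 / 2 |x|^2 (output_weight). As |z|^2 = |Q x|^2 + |delta|^2, the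
    bound on X turns into: the integral of |z|^2 is at most c2 T V(0) plus gamma times
    that of |delta|^2. *)

(** * Quadratic forms and norms *)

Definition bil (R : realType) (k : nat) (A : 'M[R]_k) (u v : 'cV[R]_k) : R :=
  (u^T *m A *m v) 0 0.

Lemma bilDl (R : realType) k (A : 'M[R]_k) u v w :
  bil A (u + v) w = bil A u w + bil A v w.
Proof. by rewrite /bil linearD/= !mulmxDl mxE. Qed.

Lemma bilDr (R : realType) k (A : 'M[R]_k) u v w :
  bil A u (v + w) = bil A u v + bil A u w.
Proof. by rewrite /bil mulmxDr mxE. Qed.

Lemma bilZl (R : realType) k (A : 'M[R]_k) a u v :
  bil A (a *: u) v = a * bil A u v.
Proof. by rewrite /bil linearZ/= -!scalemxAl mxE. Qed.

Lemma bilZr (R : realType) k (A : 'M[R]_k) a u v :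
  bil A u (a *: v) = a * bil A u v.
Proof. by rewrite /bil -scalemxAr mxE. Qed.

Lemma bilE (R : realType) k (A : 'M[R]_k) u v :
  bil A u v = \sum_i \sum_j u i 0 * A i j * v j 0.
Proof.
rewrite /bil mxE exchange_big/=; apply: eq_bigr => j _.
by rewrite mxE mulr_suml; apply: eq_bigr => i _; rewrite mxE.
Qed.

Lemma bil_trmx (R : realType) k (A : 'M[R]_k) u v : bil A^T u v = bil A v u.
Proof.
rewrite !bilE exchange_big/=; apply: eq_bigr => i _; apply: eq_bigr => j _.
by rewrite mxE; ring.
Qed.

Lemma bilC (R : realType) k (A : 'M[R]_k) u v :
  A^T = A -> bil A u v = bil A v u.
Proof. by move=> sA; rewrite -bil_trmx sA. Qed.

Lemma sqnorm_bil (R : realType) k (v : 'cV[R]_k) : sqnorm v = bil 1%:M v v.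
Proof.
by rewrite /bil mulmx1 mxE; apply: eq_bigr => i _; rewrite mxE expr2.
Qed.

Lemma bil_mul (R : realType) k m (B : 'M[R]_(m, k)) (u : 'cV[R]_k) v :
  bil 1%:M (B *m u) v = bil 1%:M u (B^T *m v).
Proof. by rewrite /bil trmx_mul !mulmx1 mulmxA. Qed.

Lemma bil_gram (R : realType) k m (B : 'M[R]_(m, k)) (u v : 'cV[R]_k) :
  bil (B^T *m B) u v = bil 1%:M (B *m u) (B *m v).
Proof. by rewrite /bil trmx_mul !mulmx1 !mulmxA. Qed.

Lemma bil_mxr (R : realType) k (A : 'M[R]_k) u v :
  bil A u v = bil 1%:M u (A *m v).
Proof. by rewrite /bil mulmx1 mulmxA. Qed.

Lemma bilNr (R : realType) k (A : 'M[R]_k) u v : bil A u (- v) = - bil A u v.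
Proof. by rewrite -scaleN1r bilZr mulN1r. Qed.

Lemma mx11_0 (R : realType) : (0 : 'M[R]_1) 0 0 = 0.
Proof. by rewrite mxE. Qed.

Lemma bil0 (R : realType) m (A : 'M[R]_m) : bil A 0 0 = 0.
Proof. by rewrite /bil mulmx0 mxE. Qed.

Lemma bil_subscalar (R : realType) k (A : 'M[R]_k) c u v :
  bil (A - c%:M) u v = bil A u v - c * bil 1%:M u v.
Proof.
rewrite /bil mulmxBr mulmxBl [LHS]mxE [X in _ + X]mxE.
by rewrite mul_mx_scalar -scalemxAl mulmx1 [X in _ - X]mxE.
Qed.

Lemma bilDl_mx (R : realType) k (A B : 'M[R]_k) u v :
  bil (A + B) u v = bil A u v + bil B u v.
Proof. by rewrite /bil mulmxDr mulmxDl mxE. Qed.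

Lemma bilZ_mx (R : realType) k (A : 'M[R]_k) c u v :
  bil (c *: A) u v = c * bil A u v.
Proof. by rewrite /bil -scalemxAr -scalemxAl mxE. Qed.

Lemma sqnorm_ge0 (R : realType) k (v : 'cV[R]_k) : 0 <= sqnorm v.
Proof. by apply: sumr_ge0 => i _; exact: sqr_ge0. Qed.

Lemma sqnorm_eq0 (R : realType) k (v : 'cV[R]_k) : (sqnorm v == 0) = (v == 0).
Proof.
apply/idP/eqP => [|->]; last first.
  by rewrite /sqnorm big1// => i _; rewrite mxE expr0n.
rewrite psumr_eq0 => [/allP v0|i _]; last exact: sqr_ge0.
apply/matrixP => i j; rewrite ord1 mxE.
by have := v0 i (mem_index_enum _); rewrite sqrf_eq0 => /eqP.
Qed.

Lemma sqnorm0 (R : realType) m : sqnorm (0 : 'cV[R]_m) = 0.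
Proof. by apply/eqP; rewrite sqnorm_eq0. Qed.

Lemma sqnorm_gt0 (R : realType) k (v : 'cV[R]_k) : (0 < sqnorm v) = (v != 0).
Proof. by rewrite lt_neqAle eq_sym sqnorm_eq0 sqnorm_ge0 andbT. Qed.

Lemma sqnorm_ones_gt0 (R : realType) k : (0 < k)%N ->
  0 < sqnorm (const_mx 1 : 'cV[R]_k).
Proof.
move=> k0; rewrite sqnorm_gt0; apply/eqP => /matrixP/(_ (Ordinal k0) 0).
by rewrite !mxE => /eqP; rewrite oner_eq0.
Qed.

Lemma sqnormZ (R : realType) k a (v : 'cV[R]_k) :
  sqnorm (a *: v) = a ^+ 2 * sqnorm v.
Proof. by rewrite !sqnorm_bil bilZl bilZr mulrA expr2. Qed.

Lemma bil_scalar (R : realType) m (c : R) (v : 'cV[R]_m) :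
  bil c%:M v v = c * sqnorm v.
Proof. by rewrite sqnorm_bil -bilZr /bil mul_mx_scalar mulmx1 -scalemxAl -scalemxAr. Qed.

Lemma sqnormD (R : realType) k (u v : 'cV[R]_k) :
  sqnorm (u + v) = sqnorm u + 2 * bil 1%:M u v + sqnorm v.
Proof.
rewrite !sqnorm_bil bilDl !bilDr (bilC v u (trmx1 _ _)); ring.
Qed.

Lemma sqnormB (R : realType) k (u v : 'cV[R]_k) :
  sqnorm (u - v) = sqnorm u - 2 * bil 1%:M u v + sqnorm v.
Proof.
by rewrite sqnormD -[- v]scaleN1r bilZr sqnormZ; ring.
Qed.

(** The form is nonnegative on the plane spanned by u and v; the combination of u
    and v with coefficients bil A v v and - bil A u v gives the inequality. *)
Lemma psd_cauchy_schwarz (R : realType) k (A : 'M[R]_k) u v : A^T = A ->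
  (forall z, 0 <= bil A z z) -> bil A u v ^+ 2 <= bil A u u * bil A v v.
Proof.
move=> sA A0.
have key a b : 0 <= a ^+ 2 * bil A u u + 2 * a * b * bil A u v
                    + b ^+ 2 * bil A v v.
  have := A0 (a *: u + b *: v).
  by rewrite bilDl !bilDr !bilZl !bilZr (bilC v u sA); lra.
have [v0|v0] := eqVneq (bil A v v) 0.
  have [uv0|uv0] := eqVneq (bil A u v) 0; first by rewrite uv0 v0; lra.
  (* on u + b v the form is affine in b, and this b would make it negative *)
  have := key 1 (- (bil A u u + 1) / (2 * bil A u v)).
  rewrite v0 mulr0 addr0 expr1n mul1r mulr1.
  rewrite [X in _ + X](_ : _ = - (bil A u u + 1)); last by field.
  lra.
have vp : 0 < bil A v v by rewrite lt_neqAle eq_sym v0 A0.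
have := key (bil A v v) (- bil A u v).
rewrite (_ : _ + _ =
  bil A v v * (bil A u u * bil A v v - bil A u v ^+ 2)); last by ring.
by rewrite pmulr_rge0// subr_ge0.
Qed.

Lemma cauchy_schwarz (R : realType) k (u v : 'cV[R]_k) :
  bil 1%:M u v ^+ 2 <= sqnorm u * sqnorm v.
Proof.
rewrite !sqnorm_bil; apply: psd_cauchy_schwarz; first exact: trmx1.
by move=> z; rewrite -sqnorm_bil sqnorm_ge0.
Qed.

(** Convexity of the form, at the combination of u / p, v / q and w / r with the
    weights p, q and r. *)
Lemma psd_young3 (R : realType) k (A : 'M[R]_k) u v w (p q r : R) :
  A^T = A -> (forall z, 0 <= bil A z z) ->
  0 < p -> 0 < q -> 0 < r -> p + q + r = 1 ->
  bil A (u + v + w) (u + v + w)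
    <= p^-1 * bil A u u + q^-1 * bil A v v + r^-1 * bil A w w.
Proof.
move=> sA A0 p0 q0 r0 pqr.
have two a b (s t : R) : 0 < s -> 0 < t ->
    2 * bil A a b <= t / s * bil A a a + s / t * bil A b b.
  move=> s0 t0; have := A0 (t *: a - s *: b).
  rewrite -scaleNr bilDl !bilDr !bilZl !bilZr (bilC b a sA) => H.
  rewrite -(ler_pM2l (mulr_gt0 s0 t0)).
  rewrite [leRHS](_ : _ = t ^+ 2 * bil A a a + s ^+ 2 * bil A b b); last first.
    by field; rewrite ?gt_eqF.
  lra.
have uv := two u v p q p0 q0; have uw := two u w p r p0 r0.
have vw := two v w q r q0 r0.
have -> : p^-1 = 1 + q / p + r / p.
  by rewrite -{1}[p^-1]mul1r -{1}pqr; field; rewrite gt_eqF.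
have -> : q^-1 = 1 + p / q + r / q.
  by rewrite -{1}[q^-1]mul1r -{1}pqr; field; rewrite gt_eqF.
have -> : r^-1 = 1 + p / r + q / r.
  by rewrite -{1}[r^-1]mul1r -{1}pqr; field; rewrite gt_eqF.
rewrite !bilDl !bilDr (bilC v u sA) (bilC w u sA) (bilC w v sA).
rewrite !mulrDl !mul1r; lra.
Qed.

Lemma enorm_ge0 (R : realType) k (v : 'cV[R]_k) : 0 <= enorm v.
Proof. exact: sqrtr_ge0. Qed.

Lemma enormZ (R : realType) k a (v : 'cV[R]_k) : enorm (a *: v) = `|a| * enorm v.
Proof.
by rewrite /enorm sqnormZ sqrtrM ?sqr_ge0// sqrtr_sqr.
Qed.

Lemma enorm_sqr (R : realType) k (v : 'cV[R]_k) : enorm v ^+ 2 = sqnorm v.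
Proof. by rewrite /enorm sqr_sqrtr ?sqnorm_ge0. Qed.

Lemma sum_cauchy_schwarz (R : realType) k (a b : 'I_k -> R) :
  (\sum_i a i * b i) ^+ 2 <= (\sum_i a i ^+ 2) * (\sum_i b i ^+ 2).
Proof.
have := cauchy_schwarz (\col_i a i) (\col_i b i).
rewrite /sqnorm /bil mulmx1 mxE.
by congr (_ ^+ 2 <= _ * _); apply: eq_bigr => i _; rewrite !mxE.
Qed.

(** The supremum that defines opnorm is over a bounded set: the Frobenius norm is a
    bound. Without this it would be a default value. *)
Lemma enorm_mulmx_bounded (R : realType) m k (A : 'M[R]_(m, k)) :
  exists2 c : R, 0 <= c & forall v, enorm (A *m v) <= c * enorm v.
Proof.
exists (Num.sqrt (\sum_i \sum_j A i j ^+ 2)); first exact: sqrtr_ge0.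
move=> v; rewrite /enorm -sqrtrM; last first.
  by apply: sumr_ge0 => i _; apply: sumr_ge0 => j _; exact: sqr_ge0.
rewrite ler_wsqrtr// mulr_suml; apply: ler_sum => i _.
by rewrite mxE; exact: sum_cauchy_schwarz.
Qed.

Lemma enorm_mulmx_le (R : realType) m k (A : 'M[R]_(m, k)) (v : 'cV[R]_k) :
  enorm (A *m v) <= opnorm A * enorm v.
Proof.
have [c c0 cP] := enorm_mulmx_bounded A.
have [->|v0] := eqVneq v 0.
  by rewrite mulmx0 -[0 : 'cV_m](scale0r 0) -[0 : 'cV_k](scale0r 0) !enormZ
     normr0 !mul0r mulr0.
have nv : 0 < enorm v by rewrite sqrtr_gt0 sqnorm_gt0.
rewrite -ler_pdivrMr// mulrC.
have -> : (enorm v)^-1 * enorm (A *m v) = enorm (A *m ((enorm v)^-1 *: v)).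
  by rewrite -scalemxAr enormZ ger0_norm ?invr_ge0// ltW.
apply: ub_le_sup.
  exists c => _ [u /= u1 <-]; apply: (le_trans (cP u)).
  by rewrite -[leRHS]mulr1 ler_wpM2l.
exists ((enorm v)^-1 *: v) => //=.
by rewrite enormZ ger0_norm ?invr_ge0 ?mulVf ?gt_eqF// ltW.
Qed.

Lemma opnorm_ge0 (R : realType) m k (A : 'M[R]_(m, k)) : 0 <= opnorm A.
Proof.
have [c c0 cP] := enorm_mulmx_bounded A.
apply: (le_trans (enorm_ge0 (A *m 0))); apply: ub_le_sup.
  exists c => _ [u /= u1 <-]; apply: (le_trans (cP u)).
  by rewrite -[leRHS]mulr1 ler_wpM2l.
by exists 0 => //=; rewrite -[0 : 'cV_k](scale0r 0) enormZ normr0 mul0r.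
Qed.

Lemma sqnorm_mulmx_le_opnorm (R : realType) m k (A : 'M[R]_(m, k)) (v : 'cV[R]_k) :
  sqnorm (A *m v) <= opnorm A ^+ 2 * sqnorm v.
Proof.
rewrite -!enorm_sqr -exprMn.
rewrite ler_pXn2r ?nnegrE ?mulr_ge0 ?opnorm_ge0 ?enorm_ge0//.
exact: enorm_mulmx_le.
Qed.

Lemma bil_le_enorm (R : realType) k (u v : 'cV[R]_k) :
  bil 1%:M u v <= enorm u * enorm v.
Proof.
apply: (le_trans (ler_norm _)).
rewrite -(@ler_pXn2r _ 2) ?nnegrE ?mulr_ge0 ?enorm_ge0//.
by rewrite real_normK ?num_real// exprMn !enorm_sqr cauchy_schwarz.
Qed.

Lemma bil_le_opnorm (R : realType) k (A : 'M[R]_k) (v : 'cV[R]_k) :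
  bil A v v <= opnorm A * sqnorm v.
Proof.
rewrite bil_mxr; apply: (le_trans (bil_le_enorm _ _)).
rewrite -enorm_sqr expr2 mulrCA ler_wpM2l ?enorm_ge0//; exact: enorm_mulmx_le.
Qed.

Lemma sqnorm_mulmx_le (R : realType) m k (B : 'M[R]_(m, k)) (c : R) v :
  opnorm (B^T *m B) <= c -> sqnorm (B *m v) <= c * sqnorm v.
Proof.
move=> Bc; rewrite sqnorm_bil -bil_gram; apply: (le_trans (bil_le_opnorm _ _)).
by rewrite ler_wpM2r ?sqnorm_ge0.
Qed.

(** With u = B^T e, the square |u|^2 is the product of B u and e, so that
    Cauchy-Schwarz gives |u|^4 <= c |u|^2 |e|^2. *)
Lemma sqnorm_trmx_mulmx_le (R : realType) m k (B : 'M[R]_(m, k)) (c : R) :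
  0 <= c -> (forall v, sqnorm (B *m v) <= c * sqnorm v) ->
  forall e, sqnorm (B^T *m e) <= c * sqnorm e.
Proof.
move=> c0 Bc e; set u := B^T *m e.
have [->|u0] := eqVneq (sqnorm u) 0; first by rewrite mulr_ge0 ?sqnorm_ge0.
have up : 0 < sqnorm u by rewrite lt_neqAle eq_sym u0 sqnorm_ge0.
rewrite -(ler_pM2l up) -[leLHS]expr2.
have uE : sqnorm u = bil 1%:M (B *m u) e by rewrite sqnorm_bil bil_mul.
rewrite {1}uE; apply: (le_trans (cauchy_schwarz _ _)).
by rewrite mulrA ler_wpM2r ?sqnorm_ge0// [leRHS]mulrC; exact: Bc.
Qed.

Lemma mxle_scalar_l (R : realType) k (A : 'M[R]_k) c :
  mxle c%:M A -> forall v, c * sqnorm v <= bil A v v.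
Proof.
by move=> H v; have := H v; rewrite -/(bil _ v v) bil_subscalar -sqnorm_bil subr_ge0.
Qed.

Lemma cross_trmx (R : realType) m k (B : 'M[R]_(m, k)) (u : 'cV[R]_k) (v : 'cV[R]_m) :
  (u^T *m B^T *m v) 0 0 = (v^T *m B *m u) 0 0.
Proof.
by rewrite -[LHS](mxE trmx_key (fun i j => (u^T *m B^T *m v) j i)) -/(trmx _)
  !trmx_mul !trmxK mulmxA.
Qed.

Lemma quadratic_block (R : realType) m k (A : 'M[R]_m) (B : 'M[R]_(m, k))
    (C : 'M[R]_(k, m)) (D : 'M[R]_k) u v :
  bil (block_mx A B C D) (col_mx u v) (col_mx u v) =
  bil A u u + (u^T *m B *m v) 0 0 + ((v^T *m C *m u) 0 0 + bil D v v).
Proof.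
rewrite /bil tr_col_mx mul_row_block mul_row_col mxE !mulmxDl.
by rewrite [X in X + _]mxE [X in _ + X = _]mxE; ring.
Qed.

Lemma mxle0_bil (R : realType) m (A : 'M[R]_m) : mxle A 0 ->
  forall v, bil A v v <= 0.
Proof.
move=> A0 v; have := A0 v; rewrite sub0r mulmxN mulNmx mxE.
by rewrite oppr_ge0.
Qed.

(** * Locally integrable functions on the half-line *)

(** Solutions are in the sense of Caratheodory: the velocity is integrable on
    bounded intervals and need not be continuous. *)
Definition locint (R : realType) (g : R -> R) : Prop :=
  forall t, 0 <= t -> lebesgue_measure.-integrable `[0, t] (EFin \o g).

Lemma locintS (R : realType) (g : R -> R) a b : locint g -> 0 <= a ->
  lebesgue_measure.-integrable `[a, b] (EFin \o g).
Proof.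
move=> gi a0; have [ab|ba] := leP a b; last first.
  by rewrite set_itv_ge ?bnd_simp -?ltNge//; exact: integrable_set0.
apply: integrableS (gi b (le_trans a0 ab)) => //.
by apply: subset_itvr; rewrite bnd_simp.
Qed.

Lemma locint_measurable (R : realType) (g : R -> R) : locint g ->
  measurable_fun (`[0, +oo[ : set R) g.
Proof.
move=> gi; rewrite itv0y_bigcup0S; apply/measurable_fun_bigcup => // n.
by apply/measurable_EFinP; apply: measurable_int (gi n.+1%:R (ler0n _ _)).
Qed.

Lemma locint_eq (R : realType) (f g : R -> R) : locint f ->
  (forall t, 0 <= t -> f t = g t) -> locint g.
Proof.
move=> fi fg t t0; apply: eq_integrable (fi t t0) => // s.
by rewrite inE/= in_itv/= => /andP[s0 _]; rewrite /= fg.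
Qed.

Lemma locintD (R : realType) (f g : R -> R) :
  locint f -> locint g -> locint (fun t => f t + g t).
Proof. by move=> fi gi t t0; exact: integrableD (fi t t0) (gi t t0). Qed.

Lemma locintZ (R : realType) a (f : R -> R) :
  locint f -> locint (fun t => a * f t).
Proof. by move=> fi t t0; exact: (integrableZl _ a (fi t t0)). Qed.

Lemma locintN (R : realType) (f : R -> R) : locint f -> locint (fun t => - f t).
Proof.
move=> fi; apply: (locint_eq (locintZ (-1) fi)) => t _; exact: mulN1r.
Qed.

Lemma locint0 (R : realType) : locint (fun=> 0 : R).
Proof. by move=> t t0; exact: integrable0. Qed.

Lemma locint_sum (R : realType) k (F : 'I_k -> R -> R) :
  (forall i, locint (F i)) -> locint (fun t => \sum_i F i t).
Proof.
move=> Fi; elim: k F Fi => [|k IH] F Fi.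
  by apply: (locint_eq (@locint0 R)) => t _; rewrite big_ord0.
apply: (locint_eq (locintD (Fi ord0) (IH _ (fun i => Fi (lift ord0 i))))).
by move=> t _; rewrite big_ord_recl.
Qed.

Lemma lebesgue_measure_segment_lty (R : realType) (a b : R) :
  (lebesgue_measure (`[a, b]%classic : set R) < +oo)%E.
Proof.
by rewrite lebesgue_measure_itv/=; case: ifP => // _; rewrite -EFinD ltry.
Qed.

Lemma locint_bounded (R : realType) (f : R -> R) :
  measurable_fun (`[0, +oo[ : set R) f ->
  (forall b, 0 <= b -> exists c, forall t, 0 <= t <= b -> `|f t| <= c) ->
  locint f.
Proof.
move=> mf bf t t0; apply: measurable_bounded_integrable => //.
- exact: lebesgue_measure_segment_lty.
- apply: measurable_funS mf => //; by apply: subset_itvl; rewrite bnd_simp.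
- have [c cP] := bf t t0; exists c; split; first exact: num_real.
  by move=> x cx s /=; rewrite in_itv/= => /cP /le_trans; apply; exact: ltW.
Qed.

Lemma locint_cst (R : realType) (a : R) : locint (fun=> a).
Proof. by apply: locint_bounded => // b _; exists `|a|. Qed.

Lemma locintM_bounded (R : realType) (h f : R -> R) :
  measurable_fun (`[0, +oo[ : set R) h ->
  (forall b, 0 <= b -> exists c, forall t, 0 <= t <= b -> `|h t| <= c) ->
  locint f -> locint (fun t => h t * f t).
Proof.
move=> mh bh fi t t0.
have h_bounded : [bounded h s | s in `[0, t]%classic].
  have [c cP] := bh t t0; exists c; split; first exact: num_real.
  by move=> x cx s /=; rewrite in_itv/= => /cP /le_trans; apply; exact: ltW.
have mh' : measurable_fun (`[0, t]%classic : set R) h.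
  by apply: measurable_funS mh => //; apply: subset_itvl; rewrite bnd_simp.
have := @integrableMr _ _ R lebesgue_measure _ _ h _ _ h_bounded (fi t t0).
by apply.
Qed.

Lemma locint_le (R : realType) (f g : R -> R) :
  measurable_fun (`[0, +oo[ : set R) f ->
  (forall t, 0 <= t -> `|f t| <= g t) -> locint g -> locint f.
Proof.
move=> mf fg gi t t0; apply: le_integrable (gi t t0) => //.
  apply/measurable_EFinP.
  by apply: measurable_funS mf => //; apply: subset_itvl; rewrite bnd_simp.
move=> s /=; rewrite in_itv/= => /andP[s0 _].
by rewrite lee_fin (le_trans (fg s s0)) ?ler_norm.
Qed.

Lemma int_split (R : realType) (g : R -> R) a b c :
  locint g -> 0 <= a -> a <= b -> b <= c ->
  \int[lebesgue_measure]_(s in `[a, c]) g s =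
  \int[lebesgue_measure]_(s in `[a, b]) g s
  + \int[lebesgue_measure]_(s in `[b, c]) g s.
Proof.
move=> gi a0 ab bc; have gac := locintS c gi a0.
rewrite -(@Rintegral_itv_obnd_cbnd _ b); last first.
  apply: integrableS gac => //.
  by apply: subset_itvr; rewrite bnd_simp.
by rewrite -(@Rintegral_itvB _ g (BLeft a) (BRight c) b)// ?bnd_simp// addrC subrK.
Qed.

Lemma int_le (R : realType) (f g : R -> R) a b :
  locint f -> locint g -> 0 <= a ->
  (forall s, a <= s <= b -> f s <= g s) ->
  \int[lebesgue_measure]_(s in `[a, b]) f s
    <= \int[lebesgue_measure]_(s in `[a, b]) g s.
Proof.
by move=> fi gi a0 fg; apply: le_Rintegral => //; exact: locintS.
Qed.

Lemma int_ge0 (R : realType) (f : R -> R) a b :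
  0 <= a -> (forall s, 0 <= s -> 0 <= f s) ->
  0 <= \int[lebesgue_measure]_(s in `[a, b]) f s.
Proof.
move=> a0 f0; apply: Rintegral_ge0 => s /=; rewrite in_itv/= => /andP[as_ _].
exact/f0/(le_trans a0).
Qed.

Lemma int_incl (R : realType) (f : R -> R) a b c d :
  locint f -> (forall s, 0 <= s -> 0 <= f s) ->
  0 <= c -> c <= a -> a <= b -> b <= d ->
  \int[lebesgue_measure]_(s in `[a, b]) f s
    <= \int[lebesgue_measure]_(s in `[c, d]) f s.
Proof.
move=> fi f0 c0 ca ab bd.
have a0 := le_trans c0 ca; have b0 := le_trans a0 ab.
rewrite (@int_split _ f c a d)// ?(le_trans ab bd)//.
rewrite (@int_split _ f a b d)//.
have := int_ge0 a c0 f0; have := int_ge0 d b0 f0; lra.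
Qed.

Lemma int_cst (R : realType) (a b c : R) : a <= b ->
  \int[lebesgue_measure]_(s in `[a, b]) c = c * (b - a).
Proof.
move=> ab; rewrite Rintegral_cst//= lebesgue_measure_itv/= lte_fin.
by case: ltP => //= ba; rewrite (le_anti (introT andP (conj ab ba))) subrr.
Qed.

Lemma intD (R : realType) (f g : R -> R) a b : locint f -> locint g -> 0 <= a ->
  \int[lebesgue_measure]_(s in `[a, b]) (f s + g s) =
  \int[lebesgue_measure]_(s in `[a, b]) f s
  + \int[lebesgue_measure]_(s in `[a, b]) g s.
Proof. by move=> fi gi a0; rewrite RintegralD//; exact: locintS. Qed.

Lemma intZ (R : realType) c (f : R -> R) a b : locint f -> 0 <= a ->
  \int[lebesgue_measure]_(s in `[a, b]) (c * f s) =
  c * \int[lebesgue_measure]_(s in `[a, b]) f s.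
Proof. by move=> fi a0; rewrite RintegralZl//; exact: locintS. Qed.

Lemma int_eq (R : realType) (f g : R -> R) a b :
  (forall s, a <= s <= b -> f s = g s) ->
  \int[lebesgue_measure]_(s in `[a, b]) f s =
  \int[lebesgue_measure]_(s in `[a, b]) g s.
Proof.
move=> fg; apply: eq_Rintegral => s; rewrite inE/= in_itv/=; exact: fg.
Qed.

Lemma int_sum (R : realType) k (F : 'I_k -> R -> R) a b :
  (forall i, locint (F i)) -> 0 <= a ->
  \int[lebesgue_measure]_(s in `[a, b]) (\sum_i F i s) =
  \sum_i \int[lebesgue_measure]_(s in `[a, b]) F i s.
Proof.
move=> Fi a0; elim: k F Fi => [|k IH] F Fi.
  rewrite big_ord0 (@int_eq _ _ (fun=> 0)) => [|s _]; last by rewrite big_ord0.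
  by rewrite /Rintegral integral0.
rewrite big_ord_recl -IH// -intD//; last exact: locint_sum.
by apply: int_eq => s _; rewrite big_ord_recl.
Qed.

Lemma primitive_continuous (R : realType) (f : R -> R) b : locint f -> 0 <= b ->
  {within `[0, b], continuous
    (fun t => \int[lebesgue_measure]_(s in `[0, t]) f s)}.
Proof.
by move=> fi b0; apply: parameterized_integral_continuous => //; exact: fi.
Qed.

Lemma primitive_measurable (R : realType) (f : R -> R) : locint f ->
  measurable_fun (`[0, +oo[ : set R)
    (fun t => \int[lebesgue_measure]_(s in `[0, t]) f s).
Proof.
move=> fi; rewrite itv0y_bigcup0S; apply/measurable_fun_bigcup => // n.
by apply: subspace_continuous_measurable_fun => //; exact: primitive_continuous.
Qed.

Lemma primitive_bounded (R : realType) (f : R -> R) b : locint f -> 0 <= b ->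
  exists c, forall t, 0 <= t <= b ->
    `|\int[lebesgue_measure]_(s in `[0, t]) f s| <= c.
Proof.
move=> fi b0; exists (\int[lebesgue_measure]_(s in `[0, b]) `|f s|).
have ni : locint (fun s => `|f s|).
  by move=> t t0; exact: integrable_norm (fi t t0).
move=> t /andP[t0 tb]; apply: (le_trans (le_normr_Rintegral _ _)) => //.
  exact: fi.
by apply: int_incl.
Qed.

(** The integral of (f - c)^2 is nonnegative, where c is the mean value of f. *)
Lemma int_sqr_le (R : realType) (f : R -> R) a b : 0 <= a -> a <= b ->
  locint f -> locint (fun s => f s ^+ 2) ->
  (\int[lebesgue_measure]_(s in `[a, b]) f s) ^+ 2
    <= (b - a) * \int[lebesgue_measure]_(s in `[a, b]) f s ^+ 2.
Proof.
move=> a0 ab fi f2i; set I := (X in X ^+ 2).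
move: ab; rewrite le_eqVlt => /predU1P[ab|ab].
  by rewrite /I -ab set_itv1 !Rintegral_set1 expr0n/= subrr mul0r.
have d0 : 0 < b - a by rewrite subr_gt0.
pose c := I / (b - a).
have : 0 <= \int[lebesgue_measure]_(s in `[a, b])
    (f s ^+ 2 + ((- 2 * c) * f s + c ^+ 2)).
  apply: int_ge0 => // s _.
  by rewrite [leRHS](_ : _ = (f s - c) ^+ 2) ?sqr_ge0//; ring.
rewrite intD//; last by apply: locintD; [exact: locintZ|exact: locint_cst].
rewrite intD//; [|exact: locintZ|exact: locint_cst].
rewrite intZ// int_cst ?(ltW ab)// -/I.
set J := (X in 0 <= X + _).
have -> : J + (- 2 * c * I + c ^+ 2 * (b - a)) = J - I ^+ 2 / (b - a).
  by rewrite /c; field; rewrite gt_eqF.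
by rewrite subr_ge0 ler_pdivrMr// [leRHS]mulrC.
Qed.

(** * The product rule for primitives *)

Lemma locint_patch (R : realType) (f : R -> R) b : locint f -> 0 <= b ->
  lebesgue_measure.-integrable setT (EFin \o (f \_ `[0, b])).
Proof.
move=> fi b0; have H := fi b b0.
have mD : measurable (`[0, b]%classic : set (measurableTypeR R)).
  exact: measurable_itv.
have := (@integrable_mkcond _ _ R lebesgue_measure _ _ mD).1 H.
by rewrite -restrict_EFin.
Qed.

(** Both sides integrate f(s) g(r) over the triangle r <= s. *)
Lemma fubini_triangle (R : realType) (f g : R -> R) b :
  locint f -> locint g -> 0 <= b ->
  \int[lebesgue_measure]_(s in `[0, b])
    (f s * \int[lebesgue_measure]_(r in `[0, s]) g r) =
  \int[lebesgue_measure]_(r in `[0, b])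
    (g r * \int[lebesgue_measure]_(s in `[r, b]) f s).
Proof.
move=> fi gi b0; pose mu := @lebesgue_measure R.
pose F := (f \_ `[0, b] : measurableTypeR R -> R).
pose G := (g \_ `[0, b] : measurableTypeR R -> R).
have Fi : mu.-integrable setT (EFin \o F) := locint_patch fi b0.
have Gi : mu.-integrable setT (EFin \o G) := locint_patch gi b0.
have mF : measurable_fun setT F by apply/measurable_EFinP; exact: measurable_int Fi.
have mG : measurable_fun setT G by apply/measurable_EFinP; exact: measurable_int Gi.
pose h (z : measurableTypeR R * measurableTypeR R) : R :=
  (F z.1 * G z.2) * (z.2 <= z.1)%R%:R.
have mh : measurable_fun setT h.
  apply: measurable_funM.
    by apply: measurable_funM; apply: measurableT_comp.
  have -> : (fun z : measurableTypeR R * measurableTypeR R => (z.2 <= z.1)%R%:R)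
      = (fun z => if (z.2 <= z.1)%R then 1 else 0) :> (_ -> R).
    by apply/boolp.funext => z; case: ifP.
  apply: measurable_fun_ifT => //; apply: measurable_fun_ler => //.
have mnF : measurable_fun setT (fun s => `|F s|%:E).
  exact: measurable_int (integrable_norm Fi).
have mnG : measurable_fun setT (fun s => `|G s|%:E).
  exact: measurable_int (integrable_norm Gi).
have G1 : ((\int[mu]_r `|G r|%:E) \is a fin_num)%E.
  exact: integrable_fin_num (integrable_norm Gi).
have ih : (mu \x mu)%E.-integrable setT (EFin \o h).
  apply/integrable12ltyP; first exact/measurable_EFinP.
  apply: (@le_lt_trans _ _ (\int[mu]_s (`|F s|%:E * \int[mu]_r `|G r|%:E))%E).
    apply: ge0_le_integral => //=.
    - by move=> s _; exact: integral_ge0.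
    - have mabs : measurable_fun setT (abse \o (EFin \o h)).
        by apply: measurableT_comp => //; exact/measurable_EFinP.
      have := @measurable_fun_fubini_tonelli_F _ _ _ _ R mu _ mabs.
      by apply => z; exact: abse_ge0.
    - exact: emeasurable_funM.
    - move=> s _; rewrite -ge0_integralZl//.
      apply: ge0_le_integral => //.
      + apply/measurable_EFinP; apply: measurableT_comp => //.
        exact: (measurable_fun_pair2 s mh).
      + exact: emeasurable_funM.
      + move=> r _; rewrite -EFinM lee_fin /h !normrM ler_piMr ?mulr_ge0//.
        by case: (r <= s)%R; rewrite ?normr1 ?normr0.
  rewrite -(fineK G1) ge0_integralZr//; last first.
    by rewrite lee_fin fine_ge0// integral_ge0.
  apply: lte_mul_pinfty => //.
  - by apply: integral_ge0.
  - exact: integrable_fin_num (integrable_norm Fi).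
  - by rewrite ltry.
have sections (k v : R -> R) (Q : R -> bool) a c y :
    (forall t, v t * (Q t)%:R = (k \_ `[a, c]) t) -> 0 <= a -> locint k ->
    (\int[mu]_t (y * v t * (Q t)%:R)%:E =
      (y * \int[mu]_(t in `[a, c]) k t)%:E)%E.
  move=> vk a0 ki; have kac := locintS c ki a0.
  rewrite -RintegralZl// /Rintegral fineK; last first.
    apply: integrable_fin_num => //; exact: (integrableZl _ y kac).
  rewrite [RHS]integral_mkcond; apply: eq_integral => t _.
  by rewrite -mulrA vk !patchE; case: ifP => //; rewrite mulr0.
rewrite /Rintegral; congr fine.
transitivity (\int[mu]_s \int[mu]_r (h (s, r))%:E)%E; last first.
  rewrite (Fubini ih) [RHS]integral_mkcond; apply: eq_integral => r _ /=.
  rewrite patchE; case: ifPn => rD; last first.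
    under eq_integral do rewrite /h /= /G patchE (negbTE rD) mulr0 mul0r.
    exact: integral0.
  have /andP[r0 rb] : 0 <= r <= b by move: rD; rewrite inE/= in_itv.
  rewrite -(sections f F (fun s => r <= s) r b)//.
    by apply: eq_integral => s _; rewrite /h /= /G patchE rD [F s * _]mulrC.
  move=> s; rewrite /F !patchE !mem_setE !in_itv/=.
  have [rs|rs] := leP r s; last by rewrite mulr0.
  by rewrite (le_trans r0 rs)/= mulr1.
rewrite [LHS]integral_mkcond; apply: eq_integral => s _ /=.
rewrite patchE; case: ifPn => sD; last first.
  under eq_integral do rewrite /h /= /F patchE (negbTE sD) !mul0r.
  by rewrite integral0.
have /andP[s0 sb] : 0 <= s <= b by move: sD; rewrite inE/= in_itv.
rewrite -(sections g G (fun r => r <= s) 0 s)//.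
  by apply: eq_integral => r _; rewrite /h /= /F patchE sD.
move=> r; rewrite /G !patchE !mem_setE !in_itv/=.
have [rs|rs] := leP r s; last by rewrite mulr0 andbF.
by rewrite (le_trans rs sb) andbT mulr1.
Qed.

Lemma primitiveM_locint (R : realType) (f g : R -> R) :
  locint f -> locint g ->
  locint (fun t => \int[lebesgue_measure]_(s in `[0, t]) f s * g t).
Proof.
move=> fi gi; apply: locintM_bounded => //; first exact: primitive_measurable.
by move=> b b0; exact: primitive_bounded.
Qed.

(** The product on the left is the integral of f(s) g(r) over a square, which the
    diagonal cuts into two triangles. *)
Lemma primitiveM (R : realType) (f g : R -> R) b :
  locint f -> locint g -> 0 <= b ->
  \int[lebesgue_measure]_(s in `[0, b]) f s *
  \int[lebesgue_measure]_(s in `[0, b]) g s =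
  \int[lebesgue_measure]_(s in `[0, b])
     (\int[lebesgue_measure]_(r in `[0, s]) g r * f s) +
  \int[lebesgue_measure]_(s in `[0, b])
     (\int[lebesgue_measure]_(r in `[0, s]) f r * g s).
Proof.
move=> fi gi b0; pose F t := \int[lebesgue_measure]_(s in `[0, t]) f s.
rewrite (_ : \int[lebesgue_measure]_(s in `[0, b])
     (\int[lebesgue_measure]_(r in `[0, s]) g r * f s) =
   \int[lebesgue_measure]_(r in `[0, b])
     (F b * g r + -1 * (F r * g r))); last first.
  rewrite -(@eq_Rintegral _ _ _ lebesgue_measure `[0, b]%classic
    (fun s => \int[lebesgue_measure]_(r in `[0, s]) g r * f s)
    (fun s => f s * \int[lebesgue_measure]_(r in `[0, s]) g r)); last first.
    by move=> s _; rewrite mulrC.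
  rewrite fubini_triangle//; apply: int_eq => r /andP[r0 rb].
  by rewrite /F (@int_split _ f 0 r b)//; ring.
have Fg := primitiveM_locint fi gi.
rewrite intD//; [|exact: locintZ|exact: locintZ].
by rewrite !intZ// mulN1r subrK.
Qed.

(** * Sliding windows *)

Lemma window_locint (R : realType) (H : R -> R) T : 0 <= T -> locint H ->
  locint (fun t => \int[lebesgue_measure]_(s in `[t, t + T]) H s).
Proof.
move=> T0 Hi; pose P t := \int[lebesgue_measure]_(s in `[0, t]) H s.
have PE t : 0 <= t -> \int[lebesgue_measure]_(s in `[t, t + T]) H s
    = P (t + T) + -1 * P t.
  by move=> t0; rewrite /P (@int_split _ H 0 t (t + T))// ?lerDl//; ring.
have Pi : locint P.
  apply: locint_bounded; first exact: primitive_measurable.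
  by move=> b b0; exact: primitive_bounded.
apply: (@locint_eq _ (fun t => P (t + T) + -1 * P t)); last first.
  by move=> t t0; rewrite PE.
apply: locintD; last exact: locintZ.
apply: locint_bounded.
  apply: (@measurable_comp _ _ _ _ _ _ (`[0, +oo[%classic : set R) P).
  - exact: measurable_itv.
  - move=> _ [t /= t0 <-]; move: t0; rewrite !in_itv/= !andbT => t0.
    exact: addr_ge0.
  - exact: primitive_measurable.
  - exact: measurable_funD.
move=> b b0; have [c cP] := primitive_bounded Hi (addr_ge0 b0 T0).
by exists c => t /andP[t0 tb]; apply: cP; rewrite addr_ge0//= lerD2r.
Qed.

(** Tonelli: an instant s lies in the windows [t, t + T] of those t that are in
    [s - T, s], a set of measure T. *)
Lemma int_window_le (R : realType) (H : R -> R) T b :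
  0 <= T -> 0 <= b -> locint H -> (forall s, 0 <= s -> 0 <= H s) ->
  \int[lebesgue_measure]_(t in `[0, b])
    \int[lebesgue_measure]_(s in `[t, t + T]) H s
  <= T * \int[lebesgue_measure]_(s in `[0, b + T]) H s.
Proof.
move=> T0 b0 Hi H0; pose mu := @lebesgue_measure R.
have bT0 := addr_ge0 b0 T0.
pose G := (H \_ `[0, b + T] : measurableTypeR R -> R).
have G0 s : 0 <= G s.
  rewrite /G patchE; case: ifPn => //; rewrite inE/= in_itv/= => /andP[s0 _].
  exact: H0.
have Gi : mu.-integrable setT (EFin \o G) := locint_patch Hi bT0.
have mG : measurable_fun setT G by apply/measurable_EFinP; exact: measurable_int Gi.
pose Q (t s : R) : bool := [&& 0 <= t, t <= b, t <= s & s <= t + T].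
pose h (z : measurableTypeR R * measurableTypeR R) : R :=
  G z.2 * (if Q z.1 z.2 then 1 else 0).
have mQ : measurable_fun setT
    (fun z : measurableTypeR R * measurableTypeR R => Q z.1 z.2).
  have m1 : measurable_fun setT
    (fst : measurableTypeR R * measurableTypeR R -> measurableTypeR R) by [].
  have m2 : measurable_fun setT
    (snd : measurableTypeR R * measurableTypeR R -> measurableTypeR R) by [].
  rewrite /Q; apply: measurable_and; first exact: measurable_fun_ler.
  apply: measurable_and; first exact: measurable_fun_ler.
  apply: measurable_and; first exact: measurable_fun_ler.
  apply: measurable_fun_ler => //; exact: measurable_funD.
have mh : measurable_fun setT h.
  apply: measurable_funM; first exact: measurableT_comp.
  exact: measurable_fun_ifT.
have h0 z : 0 <= h z by rewrite mulr_ge0//; case: ifP.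
have RE : (\int[mu]_s \int[mu]_t (h (t, s))%:E
    <= (T * \int[mu]_(s in `[0, b + T]) H s)%:E)%E.
  apply: (@le_trans _ _ (\int[mu]_s (T%:E * (G s)%:E))%E).
    apply: ge0_le_integral => //.
    - by move=> s _; apply: integral_ge0 => t _; rewrite lee_fin.
    - have := @measurable_fun_fubini_tonelli_G _ _ _ _ R mu (EFin \o h).
      by apply => //; exact/measurable_EFinP.
    - by apply/measurable_EFinP; exact: measurable_funM.
    move=> s _; have mI : measurable (`[s - T, s]%classic : set (measurableTypeR R)).
      exact: measurable_itv.
    apply: (@le_trans _ _ (\int[mu]_(t in `[(s - T)%R, s]) (G s)%:E)%E).
      rewrite [leRHS]integral_mkcond; apply: ge0_le_integral => //.
      - by move=> t _; rewrite lee_fin.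
      - by apply/measurable_EFinP; exact: (measurable_fun_pair1 s mh).
      - by apply/(measurable_restrictT _ mI); exact: measurable_cst.
      move=> t _; rewrite patchE mem_setE in_itv/= lerBlDr /h /Q/=.
      have [ts|ts] := leP t s; last by rewrite /= !andbF mulr0.
      have [st|st] := leP s (t + T); last by rewrite /= !andbF mulr0.
      by rewrite /= !andbT; case: ifP; rewrite ?mulr1// mulr0 lee_fin.
    rewrite integral_cst//= muleC; apply: lee_wpmul2r; first by rewrite lee_fin.
    rewrite /mu lebesgue_measure_itv/= lte_fin; case: ifP => _; last by rewrite lee_fin.
    by rewrite -EFinD lee_fin opprB addrC subrK.
  rewrite ge0_integralZl ?lee_fin//;
    [|exact: (measurable_int mu Gi)|by move=> s _; rewrite lee_fin].
  have iH := locintS (b + T) Hi (lexx 0).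
  rewrite EFinM /Rintegral fineK; last by apply: integrable_fin_num.
  by rewrite [in leRHS]integral_mkcond restrict_EFin.
have FT : (\int[mu]_t \int[mu]_s (h (t, s))%:E =
           \int[mu]_s \int[mu]_t (h (t, s))%:E)%E.
  have := @fubini_tonelli _ _ _ _ R mu mu (EFin \o h).
  by apply => //; exact/measurable_EFinP.
have LE : (\int[mu]_(t in `[0%R, b])
   (\int[mu]_(s in `[t, t + T]) H s)%:E = \int[mu]_t \int[mu]_s (h (t, s))%:E)%E.
  rewrite integral_mkcond; apply: eq_integral => t _ /=.
  rewrite patchE; case: ifPn => tD; last first.
    rewrite -[LHS](integral0 mu setT); apply: eq_integral => s _.
    rewrite /h /Q /=; move: tD; rewrite mem_setE in_itv/= => tD.
    by rewrite andbA (negbTE tD) mulr0.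
  have /andP[t0 tb] : 0 <= t <= b by move: tD; rewrite inE/= in_itv.
  rewrite /Rintegral fineK; last first.
    by apply: integrable_fin_num => //; exact: locintS.
  rewrite integral_mkcond; apply: eq_integral => s _.
  rewrite /h /Q /G !patchE !mem_setE !in_itv/= t0 tb/=.
  have [ts|ts] := leP t s => /=; last by rewrite mulr0.
  have [st|st] := leP s (t + T) => /=; last by rewrite mulr0.
  by rewrite (le_trans t0 ts) (le_trans st) ?lerD2r//= mulr1.
have X : (\int[mu]_(t in `[0%R, b]) (\int[mu]_(s in `[t, t + T]) H s)%:E
    <= (T * \int[mu]_(s in `[0, b + T]) H s)%:E)%E.
  by rewrite LE FT; exact: RE.
have W := window_locint T0 Hi.
by rewrite -lee_fin /Rintegral fineK//; apply: integrable_fin_num => //; exact: W.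
Qed.

(** * Absolutely continuous trajectories *)

Definition vlocint (R : realType) k (v : R -> 'cV[R]_k) : Prop :=
  forall i, locint (fun s => v s i 0).

Definition primitive_of (R : realType) k (x0 : 'cV[R]_k) (v x : R -> 'cV[R]_k) :
  Prop := forall t, 0 <= t -> x t = x0 + mxint `[0, t] v.

Lemma mxint_split (R : realType) k (v : R -> 'cV[R]_k) a b c :
  vlocint v -> 0 <= a -> a <= b -> b <= c ->
  mxint `[a, c] v = mxint `[a, b] v + mxint `[b, c] v.
Proof.
move=> vi a0 ab bc; apply/matrixP => i j; rewrite !mxE.
by rewrite !ord1; apply: int_split.
Qed.

Lemma mxintD (R : realType) k (u v : R -> 'cV[R]_k) a b :
  vlocint u -> vlocint v -> 0 <= a ->
  mxint `[a, b] (fun s => u s + v s) = mxint `[a, b] u + mxint `[a, b] v.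
Proof.
move=> ui vi a0; apply/matrixP => i j; rewrite !mxE !ord1 -intD//.
by apply: int_eq => s _; rewrite mxE.
Qed.

Lemma vlocintD (R : realType) k (u v : R -> 'cV[R]_k) :
  vlocint u -> vlocint v -> vlocint (fun s => u s + v s).
Proof.
by move=> ui vi i; apply: locint_eq (locintD (ui i) (vi i)) _ => t _; rewrite mxE.
Qed.

Lemma vlocintN (R : realType) k (u : R -> 'cV[R]_k) :
  vlocint u -> vlocint (fun s => - u s).
Proof. by move=> ui i; apply: locint_eq (locintN (ui i)) _ => t _; rewrite mxE. Qed.

Lemma vlocint_mulmx (R : realType) m k (A : 'M[R]_(m, k)) (u : R -> 'cV[R]_k) :
  vlocint u -> vlocint (fun s => A *m u s).
Proof.
move=> ui i.
have H : locint (fun s => \sum_j A i j * u s j 0).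
  by apply: locint_sum => j; exact: locintZ.
by apply: locint_eq H _ => t _; rewrite mxE.
Qed.

Lemma primitive_increment (R : realType) k x0 (v x : R -> 'cV[R]_k) t s :
  vlocint v -> primitive_of x0 v x -> 0 <= t -> t <= s ->
  x s = x t + mxint `[t, s] v.
Proof.
move=> vi xP t0 ts; rewrite !xP ?(le_trans t0 ts)//.
by rewrite (@mxint_split _ _ v 0 t s)// addrA.
Qed.

Lemma measurable_eq_nonneg (R : realType) (f g : R -> R) :
  measurable_fun (`[0, +oo[%classic : set R) f ->
  (forall t, 0 <= t -> f t = g t) ->
  measurable_fun (`[0, +oo[%classic : set R) g.
Proof.
move=> mf fg; apply: eq_measurable_fun mf => t.
by rewrite inE/= in_itv/= andbT => /fg.
Qed.

Lemma primitive_of_measurable (R : realType) k x0 (v x : R -> 'cV[R]_k) i :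
  vlocint v -> primitive_of x0 v x ->
  measurable_fun (`[0, +oo[%classic : set R) (fun t => x t i 0).
Proof.
move=> vi xP.
apply: (@measurable_eq_nonneg _
  (fun t => x0 i 0 + \int[lebesgue_measure]_(s in `[0, t]) v s i 0)).
  by apply: measurable_funD => //; exact: primitive_measurable.
by move=> t t0; rewrite xP// !mxE.
Qed.

Lemma primitive_of_bounded (R : realType) k x0 (v x : R -> 'cV[R]_k) i b :
  vlocint v -> primitive_of x0 v x -> 0 <= b ->
  exists c, forall t, 0 <= t <= b -> `|x t i 0| <= c.
Proof.
move=> vi xP b0; have [c cP] := primitive_bounded (vi i) b0.
exists (`|x0 i 0| + c) => t tb; have /andP[t0 _] := tb.
rewrite xP// !mxE (le_trans (ler_normD _ _))// lerD2l.
exact: cP.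
Qed.

Lemma primitive_ofM_locint (R : realType) k x0 (v x : R -> 'cV[R]_k) i g :
  vlocint v -> primitive_of x0 v x -> locint g -> locint (fun t => x t i 0 * g t).
Proof.
move=> vi xP gi; apply: locintM_bounded => //.
  exact: primitive_of_measurable vi xP.
by move=> b b0; exact: primitive_of_bounded vi xP b0.
Qed.

Lemma primitive_of_locint (R : realType) k x0 (v x : R -> 'cV[R]_k) :
  vlocint v -> primitive_of x0 v x -> vlocint x.
Proof.
move=> vi xP i; apply: locint_eq (primitive_ofM_locint i vi xP (locint_cst 1)) _.
by move=> t _; rewrite mulr1.
Qed.

Lemma bil_locint (R : realType) k x0 (v x : R -> 'cV[R]_k) (A : R -> 'M[R]_k)
    (u : R -> 'cV[R]_k) :
  vlocint v -> primitive_of x0 v x ->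
  (forall i j, locint (fun t => A t i j * u t j 0)) ->
  locint (fun t => bil (A t) (x t) (u t)).
Proof.
move=> vi xP Au.
have H : locint (fun t => \sum_i \sum_j x t i 0 * (A t i j * u t j 0)).
  by apply: locint_sum => i; apply: locint_sum => j;
  exact: (primitive_ofM_locint i vi xP (Au i j)).
apply: locint_eq H _ => t _; rewrite bilE.
by apply: eq_bigr => i _; apply: eq_bigr => j _; rewrite mulrA.
Qed.

Lemma bil_cst_locint (R : realType) k x0 (v x : R -> 'cV[R]_k) (A : 'M[R]_k)
    (u : R -> 'cV[R]_k) :
  vlocint v -> primitive_of x0 v x -> vlocint u ->
  locint (fun t => bil A (x t) (u t)).
Proof.
move=> vi xP ui; apply: (@bil_locint _ _ _ _ _ (fun=> A)) vi xP _ => i j.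
exact: locintZ.
Qed.

Lemma primitive_of_sqnorm_locint (R : realType) k x0 (v x : R -> 'cV[R]_k) :
  vlocint v -> primitive_of x0 v x -> locint (fun t => sqnorm (x t)).
Proof.
move=> vi xP; have xi := primitive_of_locint vi xP.
by apply: locint_eq (bil_cst_locint 1%:M vi xP xi) _ => t _; rewrite sqnorm_bil.
Qed.

(** The derivative of x^T A x along x' = v. As x is only absolutely continuous,
    this rests on the product rule for primitives. *)
Lemma quadratic_chain_rule (R : realType) k x0 (v x : R -> 'cV[R]_k)
    (A : 'M[R]_k) b :
  A^T = A -> vlocint v -> primitive_of x0 v x -> 0 <= b ->
  bil A (x b) (x b) =
  bil A x0 x0 + 2 * \int[lebesgue_measure]_(s in `[0, b]) bil A (x s) (v s).
Proof.
move=> sA vi xP b0; pose X t : 'cV[R]_k := mxint `[0, t] v.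
have Xi i j : locint (fun s => A i j * (X s i 0 * v s j 0)).
  apply: locintZ; apply: locint_eq (primitiveM_locint (vi i) (vi j)) _.
  by move=> t t0; rewrite mxE.
have -> : \int[lebesgue_measure]_(s in `[0, b]) bil A (x s) (v s) =
    bil A x0 (X b) + \sum_i \sum_j A i j *
      \int[lebesgue_measure]_(s in `[0, b]) (X s i 0 * v s j 0).
  transitivity (\int[lebesgue_measure]_(s in `[0, b])
      (bil A x0 (v s) + \sum_i \sum_j A i j * (X s i 0 * v s j 0))).
    apply: int_eq => s /andP[s0 _]; rewrite xP// bilDl; congr +%R.
    rewrite bilE; apply: eq_bigr => i _; apply: eq_bigr => j _.
    by rewrite -/(X s); ring.
  have L1 i j : locint (fun s => x0 i 0 * A i j * v s j 0) by exact: locintZ.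
  have L0 : locint (fun s => bil A x0 (v s)).
    have H : locint (fun s => \sum_i \sum_j x0 i 0 * A i j * v s j 0).
      by apply: locint_sum => i; apply: locint_sum => j.
    by apply: locint_eq H _ => t _; rewrite bilE.
  rewrite intD//; last by apply: locint_sum => i; exact: locint_sum.
  congr +%R.
    transitivity (\int[lebesgue_measure]_(s in `[0, b])
        \sum_i \sum_j x0 i 0 * A i j * v s j 0).
      by apply: int_eq => s _; rewrite bilE.
    rewrite int_sum// => [|i]; last exact: locint_sum.
    rewrite bilE; apply: eq_bigr => i _; rewrite int_sum//.
    by apply: eq_bigr => j _; rewrite intZ// /X mxE.
  rewrite int_sum// => [|i]; last exact: locint_sum.
  apply: eq_bigr => i _; rewrite int_sum//.
  apply: eq_bigr => j _; rewrite intZ//.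
  apply: locint_eq (primitiveM_locint (vi i) (vi j)) _.
  by move=> t t0; rewrite mxE.
have XX : bil A (X b) (X b) = 2 * \sum_i \sum_j A i j *
      \int[lebesgue_measure]_(s in `[0, b]) (X s i 0 * v s j 0).
  rewrite mulr2n mulrDl mul1r {1}exchange_big/= -big_split/= bilE.
  apply: eq_bigr => i _; rewrite -big_split/=; apply: eq_bigr => j _.
  rewrite -[A j i](mxE trmx_key (fun i j => A j i)) -/(trmx A) sA -mulrDr.
  rewrite [X in X * _]mulrC -mulrA; congr (_ * _); rewrite /X [LHS]mulrC !mxE.
  rewrite mulrC primitiveM//.
  by congr (_ + _); apply: int_eq => s _; rewrite mxE.
rewrite xP// -/(X b) bilDl !bilDr (bilC (X b) x0 sA) XX; ring.
Qed.

(** * Excitation along a trajectory *)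

Lemma int_ramp (R : realType) (t T : R) : 0 <= t -> 0 <= T ->
  locint (fun s => s - t) /\
  \int[lebesgue_measure]_(s in `[t, t + T]) (s - t) = T ^+ 2 / 2.
Proof.
move=> t0 T0.
have one (b : R) : 0 <= b -> \int[lebesgue_measure]_(s in `[0, b]) (1 : R) = b.
  by move=> b0; rewrite int_cst// mul1r subr0.
have idi : locint (fun s : R => s).
  apply: locint_eq (primitiveM_locint (@locint_cst _ 1) (@locint_cst _ 1)) _.
  by move=> s s0; rewrite one// mulr1.
have sq (b : R) : 0 <= b -> \int[lebesgue_measure]_(s in `[0, b]) s = b ^+ 2 / 2.
  move=> b0; have := primitiveM (@locint_cst R 1) (@locint_cst R 1) b0.
  rewrite one// (@int_eq _ _ (fun s => s)) => [|s /andP[s0 _]]; last first.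
    by rewrite one// mulr1.
  lra.
have Li : locint (fun s => s - t).
  by apply: locintD => //; exact: locint_cst.
split=> //.
have tT : t <= t + T by rewrite lerDl.
rewrite intD//; last exact: locint_cst.
rewrite int_cst//.
have := @int_split _ (fun s => s) 0 t (t + T) idi (lexx 0) t0 tT.
rewrite !sq ?addr_ge0//.
move=> H; have -> : \int[lebesgue_measure]_(s in `[t, (t + T)]) s
   = (t + T) ^+ 2 / 2 - t ^+ 2 / 2 by lra.
by field.
Qed.

Lemma sqnorm_mxint_le (R : realType) k (v : R -> 'cV[R]_k) a b :
  0 <= a -> a <= b -> vlocint v -> locint (fun s => sqnorm (v s)) ->
  sqnorm (mxint `[a, b] v)
    <= (b - a) * \int[lebesgue_measure]_(s in `[a, b]) sqnorm (v s).
Proof.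
move=> a0 ab vi v2i.
have vi2 i : locint (fun s => v s i 0 ^+ 2).
  apply: locint_le v2i.
    by apply: measurable_funX; exact: locint_measurable.
  move=> t _; rewrite ger0_norm ?sqr_ge0// /sqnorm (bigD1 i)//= lerDl.
  by apply: sumr_ge0 => j _; exact: sqr_ge0.
rewrite int_sum// mulr_sumr; apply: ler_sum => i _.
by rewrite mxE; exact: int_sqr_le.
Qed.

(** Inside the window, x(t) is x(s) plus the integrals over [t, s] of the two parts a
    and b of the velocity. Convexity of M(s) splits these three terms, and
    Cauchy-Schwarz bounds the square of each integral by s - t times the energy
    of a or b. The ramp s - t integrates to T^2 / 2. The weights are left free. *)
Lemma excitation_window (R : realType) k (M : R -> 'M[R]_k) x0
    (a b v x : R -> 'cV[R]_k) (r4 l T S p q t : R) :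
  0 < T -> 0 <= t -> 0 <= r4 -> 0 < S -> 0 < p -> 0 < q ->
  S^-1 + p + q = 1 ->
  vlocint a -> vlocint b ->
  locint (fun s => sqnorm (a s)) -> locint (fun s => sqnorm (b s)) ->
  (forall s, 0 <= s -> v s = - (a s + b s)) -> primitive_of x0 v x ->
  (forall i j, locint (fun s => M s i j)) ->
  (forall s, 0 <= s -> (M s)^T = M s) ->
  (forall s z, 0 <= s -> 0 <= bil (M s) z z <= r4 * sqnorm z) ->
  (forall z, l * sqnorm z
     <= \int[lebesgue_measure]_(s in `[t, t + T]) bil (M s) z z) ->
  l * sqnorm (x t) <=
    \int[lebesgue_measure]_(s in `[t, t + T])
      (S * bil (M s) (x s) (x s)
       + T ^+ 2 / 2 * r4 * (p^-1 * sqnorm (a s) + q^-1 * sqnorm (b s))).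
Proof.
move=> T0 t0 r40 S0 p0 q0 Spq ai bi a2i b2i vE xP Mi sM Mb /(_ (x t)).
move/le_trans; apply.
have tT : t <= t + T by rewrite lerDl ltW.
have vi : vlocint v.
  have vi' : vlocint (fun s => - (a s + b s)) by exact/vlocintN/vlocintD.
  by move=> i; apply: locint_eq (vi' i) _ => s s0; rewrite vE.
have Mxi : locint (fun s => bil (M s) (x s) (x s)).
  apply: (bil_locint vi xP) => i j.
  apply: locint_eq (primitive_ofM_locint j vi xP (Mi i j)) _ => s _.
  exact: mulrC.
pose A := \int[lebesgue_measure]_(s in `[t, t + T]) sqnorm (a s).
pose B := \int[lebesgue_measure]_(s in `[t, t + T]) sqnorm (b s).
pose c := r4 * (p^-1 * A + q^-1 * B).
have [ri rE] := int_ramp t0 (ltW T0).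
have c2i : locint (fun s => p^-1 * sqnorm (a s) + q^-1 * sqnorm (b s)).
  by apply: locintD; exact: locintZ.
rewrite intD//; [|exact: locintZ|exact: locintZ].
rewrite intZ// [X in _ <= _ + X]intZ// [X in _ <= _ + _ * X]intD//;
  [|exact: locintZ|exact: locintZ].
rewrite intZ// [X in _ <= _ + _ * (_ + X)]intZ// -/A -/B.
rewrite (_ : T ^+ 2 / 2 * r4 * (p^-1 * A + q^-1 * B) = c * (T ^+ 2 / 2));
  last by rewrite /c; ring.
rewrite -rE -intZ// -[X in _ <= _ + X]intZ// -intD//;
  [|exact: locintZ|exact: locintZ].
apply: int_le => //.
- have H : locint (fun s => \sum_i \sum_j x t i 0 * x t j 0 * M s i j).
    by apply: locint_sum => i; apply: locint_sum => j; exact: locintZ.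
  apply: locint_eq H _ => s _; rewrite bilE.
  by apply: eq_bigr => i _; apply: eq_bigr => j _; ring.
- by apply: locintD; exact: locintZ.
move=> s /andP[ts sT]; have s0 := le_trans t0 ts.
have xE : x t = x s + mxint `[t, s] a + mxint `[t, s] b.
  rewrite (primitive_increment vi xP t0 ts) -!addrA -mxintD//.
  rewrite -[LHS]addr0; congr (_ + _); apply/matrixP => i j.
  rewrite !mxE ord1; apply/esym/eqP; rewrite addr_eq0; apply/eqP.
  rewrite -mulN1r -intZ//; last exact: vlocintD.
  by apply: int_eq => u /andP[tu _]; rewrite vE ?(le_trans t0 tu)// !mxE mulN1r.
rewrite {1 2}xE.
have M0 z : 0 <= bil (M s) z z by have /andP[] := Mb s z s0.
have Sp : 0 < S^-1 by rewrite invr_gt0.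
apply: (le_trans (psd_young3 _ _ _ (sM s s0) M0 Sp p0 q0 Spq)).
rewrite invrK -addrA lerD2l /c.
have part (w : R -> 'cV[R]_k) : vlocint w -> locint (fun s => sqnorm (w s)) ->
    bil (M s) (mxint `[t, s] w) (mxint `[t, s] w) <=
    r4 * ((s - t) * \int[lebesgue_measure]_(s in `[t, t + T]) sqnorm (w s)).
  move=> wi w2i; have /andP[_ H] := Mb s (mxint `[t, s] w) s0.
  apply: (le_trans H); rewrite ler_wpM2l//.
  apply: (le_trans (sqnorm_mxint_le t0 ts wi w2i)).
  rewrite ler_wpM2l ?subr_ge0//; apply: int_incl => // u _; exact: sqnorm_ge0.
rewrite (_ : r4 * (p^-1 * A + q^-1 * B) * (s - t) =
  p^-1 * (r4 * ((s - t) * A)) + q^-1 * (r4 * ((s - t) * B))); last by ring.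
by apply: lerD; rewrite ler_pM2l ?invr_gt0//; exact: part.
Qed.

(** * From dissipation to a bound on the state *)

(** Let X(b) be the integral of |x|^2 over [0, b]. Integrating the dissipation
    inequality bounds the integral of H by V(0) + Y + c X(b) / (2 T), and the
    windows turn this into c X(b) <= T (V(0) + Y) + (c / 2) X(b + T).
    To absorb the last term, X must be known to be bounded. The increment of X over
    [b, b + T] is controlled by the storage function there, hence by X(b + T)
    itself with the factor r c / 2, which is at most 1/4. At the supremum of X the
    two sides compare and the factor 1/2 becomes the 2 of the conclusion. *)
Lemma dissipation_state_bound (R : realType) k x0 (v x : R -> 'cV[R]_k)
    (A : 'M[R]_k) (H e : R -> R) (T c r Y : R) :
  0 < T -> 0 < c -> 0 < r -> r * c <= 1 / 2 ->
  A^T = A -> vlocint v -> primitive_of x0 v x ->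
  (forall z, sqnorm z <= r * bil A z z) ->
  locint H -> (forall s, 0 <= s -> 0 <= H s) ->
  locint e -> (forall b, 0 <= b ->
     \int[lebesgue_measure]_(s in `[0, b]) e s <= Y) ->
  (forall t, 0 <= t -> c * sqnorm (x t)
     <= \int[lebesgue_measure]_(s in `[t, t + T]) H s) ->
  (forall s, 0 <= s -> H s + 2 * bil A (x s) (v s)
     <= e s + c / (2 * T) * sqnorm (x s)) ->
  forall b, 0 <= b ->
    c * \int[lebesgue_measure]_(s in `[0, b]) sqnorm (x s)
      <= 2 * T * (bil A x0 x0 + Y).
Proof.
move=> T0 c0 r0 rc sA vi xP Ar Hi H0 ei eY win diss.
set V0 := bil A x0 x0.
pose X b := \int[lebesgue_measure]_(s in `[0, b]) sqnorm (x s).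
have x2i := primitive_of_sqnorm_locint vi xP.
have Vi := bil_cst_locint A vi xP vi.
have T2 : 0 < 2 * T by rewrite mulr_gt0.
have energy b : 0 <= b ->
    \int[lebesgue_measure]_(s in `[0, b]) H s + bil A (x b) (x b)
      <= V0 + Y + c / (2 * T) * X b.
  move=> b0; rewrite (quadratic_chain_rule sA vi xP b0) -/V0 addrCA -addrA lerD2l.
  rewrite -intZ// -intD//; last exact: locintZ.
  apply: (@le_trans _ _ (\int[lebesgue_measure]_(s in `[0, b])
    (e s + c / (2 * T) * sqnorm (x s)))).
    apply: int_le => //.
    - by apply: locintD => //; exact: locintZ.
    - by apply: locintD => //; exact: locintZ.
    by move=> s /andP[s0 _]; exact: diss.
  rewrite intD//; last exact: locintZ.
  by rewrite intZ// lerD2r eY.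
have sumH b : 0 <= b -> c * X b <= T * (V0 + Y) + c / 2 * X (b + T).
  move=> b0; have bT0 : 0 <= b + T by rewrite addr_ge0// ltW.
  have step : c * X b <= T * \int[lebesgue_measure]_(s in `[0, b + T]) H s.
    apply: le_trans (int_window_le (ltW T0) b0 Hi H0).
    rewrite /X -intZ//; apply: int_le => //; first exact: locintZ.
      exact: window_locint (ltW T0) Hi.
    by move=> s /andP[s0 _]; exact: win.
  apply: (le_trans step).
  have -> : T * (V0 + Y) + c / 2 * X (b + T) =
            T * (V0 + Y + c / (2 * T) * X (b + T)) by field; rewrite gt_eqF.
  rewrite ler_pM2l//; apply: le_trans (energy _ bT0); rewrite lerDl.
  have := Ar (x (b + T)); have := sqnorm_ge0 (x (b + T)).
  by move=> x2 /(le_trans x2); rewrite pmulr_rge0.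
have X0 b : 0 <= X b by apply: int_ge0 => // s _; exact: sqnorm_ge0.
have Xmono a b : 0 <= a -> a <= b -> X a <= X b.
  by move=> a0 ab; apply: int_incl => // s _; exact: sqnorm_ge0.
have bounded b : 0 <= b -> c * X b <= 4 * (T * (V0 + Y) + T * (r * c) * (V0 + Y)).
  move=> b0; have bT0 : 0 <= b + T by rewrite addr_ge0// ltW.
  have tail : X (b + T) <= X b + T * (r * (V0 + Y + c / (2 * T) * X (b + T))).
    have bT : b <= b + T by rewrite lerDl ltW.
    rewrite {1}/X (@int_split _ _ 0 b (b + T))// -/(X b) lerD2l.
    have -> : T * (r * (V0 + Y + c / (2 * T) * X (b + T))) =
      \int[lebesgue_measure]_(s in `[b, b + T])
         (r * (V0 + Y + c / (2 * T) * X (b + T))).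
      by rewrite int_cst//; ring.
    apply: int_le => //; first exact: locint_cst.
    move=> s /andP[bs sbT]; have s0 := le_trans b0 bs.
    apply: (le_trans (Ar _)); rewrite ler_pM2l//.
    have en := energy s s0; have Hs := int_ge0 s (lexx 0) H0.
    have : c / (2 * T) * X s <= c / (2 * T) * X (b + T).
      by rewrite ler_pM2l ?divr_gt0//; exact: Xmono.
    lra.
  have := sumH b b0; have := Xmono b (b + T) b0; rewrite lerDl => /(_ (ltW T0)).
  move: tail.
  have -> : T * (r * (V0 + Y + c / (2 * T) * X (b + T))) =
     T * r * (V0 + Y) + (r * c) / 2 * X (b + T) by field; rewrite gt_eqF.
  set B := X (b + T) => tail Bm sH.
  have B0 : 0 <= B by exact: X0.
  have rcB : r * c * B <= 1 / 2 * B by rewrite ler_wpM2r.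
  have : c * B <= c * (X b + T * r * (V0 + Y) + 1 / 4 * B).
    rewrite ler_pM2l//; lra.
  have : c * X b <= c * B by rewrite ler_pM2l.
  rewrite !mulrDr; lra.
pose E := [set X b | b in [set b | 0 <= b]].
have E0 : E !=set0 by exists (X 0); exists 0 => /=.
have Eub : has_ubound E.
  exists (c^-1 * (4 * (T * (V0 + Y) + T * (r * c) * (V0 + Y)))) => _ [b /= b0 <-].
  by rewrite -(ler_pM2l c0) mulVKf ?gt_eqF//; exact: bounded.
have XE b : 0 <= b -> X b <= sup E by move=> b0; apply: ub_le_sup => //; exists b.
have supE : sup E <= c^-1 * (T * (V0 + Y) + c / 2 * sup E).
  apply: ge_sup => // _ [b /= b0 <-].
  rewrite -(ler_pM2l c0) mulVKf ?gt_eqF//.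
  apply: (le_trans (sumH b b0)); rewrite lerD2l ler_pM2l ?divr_gt0//.
  by apply: XE; rewrite addr_ge0// ltW.
move=> b b0; have := XE b b0; rewrite -(ler_pM2l c0) => /le_trans; apply.
have : c * sup E <= T * (V0 + Y) + c / 2 * sup E.
  by move: supE; rewrite ler_pdivlMl.
lra.
Qed.

(** * The constants of the design *)

(** Multiplying by the conjugate of the difference of square roots removes the
    singularity at phi1 = 1, so that one formula covers both branches. *)
Lemma iota3_lo_rational (R : realType) (r1 h l : R) : 0 < l -> l <= h ->
  iota3_lo r1 h l =
  l ^+ 2 / (Num.sqrt (h - l + phi1 r1 h * l) + Num.sqrt h) ^+ 2.
Proof.
move=> l0 lh; have h0 := lt_le_trans l0 lh.
have f0 : 0 <= phi1 r1 h by rewrite divr_ge0// mulr_ge0// sqr_ge0.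
have v0 : 0 < Num.sqrt h by rewrite sqrtr_gt0.
have u0 := sqrtr_ge0 (h - l + phi1 r1 h * l).
have uvn : Num.sqrt (h - l + phi1 r1 h * l) + Num.sqrt h != 0.
  by rewrite gt_eqF// ltr_wpDl.
have w0 : 0 <= h - l + phi1 r1 h * l.
  by apply: addr_ge0; [rewrite subr_ge0|rewrite mulr_ge0// ltW].
have h0' := ltW h0.
rewrite /iota3_lo; case: ifPn => [/eqP f1|f1].
  rewrite f1 mul1r subrK -mulr2n -[_ *+ 2]mulr_natl exprMn sqr_sqrtr//.
  by rewrite -natrX.
rewrite -expr_div_n; congr (_ ^+ 2).
apply: (mulIf uvn); rewrite divfK// mulrAC -subr_sqr !sqr_sqrtr//.
have -> : h - l + phi1 r1 h * l - h = l * (phi1 r1 h - 1) by ring.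
by rewrite mulfK// subr_eq0.
Qed.

(** The lower excitation constant is l / S, where
    S l = (sqrt (h - l + (r1 h)^2 l / 2) + sqrt h)^2. The weights 1/S,
    (r1 h)^2 / (2 S) and q are those of the window estimate for the state, the
    gradient term and the drift. Writing u and v for the two square roots,
    q S l >= 2 u v and S l >= 4 u v, while (u v)^2 >= (r1 h)^2 l h / 2: hence the
    last two bounds, which say that what the drift term costs is dominated by
    what Young's inequality costs anyway, and that the state is absorbed. *)
Lemma iota3_lo_weights (R : realType) (r1 h l : R) :
  0 < r1 -> 0 <= l -> l <= h -> 0 < iota3_lo r1 h l ->
  exists S q : R, [/\ 0 < S, 0 < q & 0 < l] /\
   [/\ S^-1 + (r1 * h) ^+ 2 / (2 * S) + q = 1, iota3_lo r1 h l = l / S,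
       r1 ^+ 2 * h * iota3_lo r1 h l <= 4 * (q * S)
     & r1 * iota3_lo r1 h l <= 1 / 2].
Proof.
move=> r0; rewrite le_eqVlt => /predU1P[<- h0|l0 lh].
  rewrite /iota3_lo; case: ifP => _; first by rewrite expr0n/= mul0r ltxx.
  by rewrite mulr0 addr0 subr0 subrr mul0r expr0n/= ltxx.
have h0 := lt_le_trans l0 lh.
rewrite iota3_lo_rational//; set u := Num.sqrt (h - l + _); set v := Num.sqrt h.
move=> _.
have v0 : 0 < v by rewrite sqrtr_gt0.
have u2 : u ^+ 2 = h - l + (r1 * h) ^+ 2 / 2 * l.
  rewrite /u sqr_sqrtr; first by rewrite /phi1; ring.
  by rewrite addr_ge0 ?subr_ge0// mulr_ge0 ?(ltW l0)// divr_ge0// mulr_ge0 ?sqr_ge0.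
have v2 : v ^+ 2 = h by rewrite sqr_sqrtr// ltW.
have u0 : 0 <= u by exact: sqrtr_ge0.
have rh0 : 0 < r1 * h by rewrite mulr_gt0.
have uv2 : (r1 * h) ^+ 2 / 2 * l * h <= (u * v) ^+ 2.
  by rewrite [leRHS]exprMn u2 v2 ler_pM2r// lerDr subr_ge0.
have uv_ge : r1 * l ^+ 2 / 2 <= u * v.
  have uv0 : 0 <= u * v by rewrite mulr_ge0 ?(ltW v0).
  have rl0 : 0 <= r1 * l ^+ 2 / 2 by rewrite divr_ge0// mulr_ge0 ?sqr_ge0 ?(ltW r0).
  rewrite -(@ler_pXn2r _ 2)// ?nnegrE//; apply: le_trans uv2.
  have -> : (r1 * l ^+ 2 / 2) ^+ 2 = r1 ^+ 2 / 4 * l * (l ^+ 3) by field.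
  have -> : (r1 * h) ^+ 2 / 2 * l * h = r1 ^+ 2 / 2 * l * (h ^+ 3) by ring.
  apply: ler_pM => //.
  - by rewrite mulr_ge0 ?divr_ge0 ?sqr_ge0 ?(ltW l0).
  - by rewrite exprn_ge0// ltW.
  - by rewrite ler_pM2r//; have := sqr_ge0 r1; lra.
  - by apply: lerXn2r; rewrite ?nnegrE ?(ltW l0) ?(ltW h0).
have uv_gt0 : 0 < u * v
  by apply: lt_le_trans uv_ge; rewrite divr_gt0// mulr_gt0// exprn_gt0.
have sq4 : 4 * (u * v) <= (u + v) ^+ 2 by have := sqr_ge0 (u - v); lra.
have s0 : 0 < (u + v) ^+ 2 by rewrite exprn_gt0// ltr_wpDl.
pose S := (u + v) ^+ 2 / l.
have S0 : 0 < S by rewrite divr_gt0.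
pose q := 1 - S^-1 - (r1 * h) ^+ 2 / (2 * S).
have qE : q * S * l = 2 * (h - l) + 2 * (u * v).
  have -> : q * S * l = S * l - l - (r1 * h) ^+ 2 / 2 * l.
    by rewrite /q; field; rewrite gt_eqF.
  rewrite /S divfK ?gt_eqF// sqrrD u2 v2; ring.
have qSl : 2 * (u * v) <= q * S * l by rewrite qE; lra.
have q0 : 0 < q.
  have : 0 < q * (S * l) by rewrite mulrA (lt_le_trans _ qSl)// mulr_gt0.
  by rewrite pmulr_lgt0// mulr_gt0.
exists S, q; split; first by split.
have E : l ^+ 2 / (u + v) ^+ 2 = l / S.
  by rewrite /S; field; rewrite !gt_eqF// ltr_wpDl.
split=> //; first by rewrite /q; ring.
- rewrite mulrA ler_pdivrMr// -(ler_pM2r l0).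
  apply: (@le_trans _ _ (16 * ((r1 * h) ^+ 2 * l * h))).
    have : l ^+ 2 <= h ^+ 2 by apply: lerXn2r; rewrite ?nnegrE ?(ltW l0) ?(ltW h0).
    rewrite -(@ler_pM2l _ (r1 ^+ 2 * h * l)) ?mulr_gt0 ?exprn_gt0// => H.
    have : 0 <= r1 ^+ 2 * h * l * h ^+ 2.
      by rewrite !mulr_ge0 ?exprn_ge0 ?(ltW r0) ?(ltW h0) ?(ltW l0).
    lra.
  apply: (@le_trans _ _ (4 * ((2 * (u * v)) * (4 * (u * v))))); first lra.
  have -> : 4 * (q * S) * (u + v) ^+ 2 * l = 4 * ((q * S * l) * (u + v) ^+ 2).
    by ring.
  by rewrite ler_pM2l// ler_pM// mulr_ge0// ltW.
- by rewrite mulrA ler_pdivrMr//; lra.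
Qed.

(** * Spectral gap of a symmetric matrix *)

Lemma continuous_rV_quadratic (R : realType) n (M : 'M[R]_n.+1) :
  continuous (fun v : 'rV[R]_n.+1 => bil M v^T v^T).
Proof.
have -> : (fun v : 'rV[R]_n.+1 => bil M v^T v^T) =
    (fun v => \sum_i \sum_j v 0 i * M i j * v 0 j).
  apply/boolp.funext => v; rewrite bilE; apply: eq_bigr => i _.
  by apply: eq_bigr => j _; rewrite !mxE.
apply: continuous_big => [|i _ v]; first exact: add_continuous.
apply: continuous_big => [|j _ {}v]; first exact: add_continuous.
exact: (cvgM (cvgM (@coord_continuous _ _ _ 0 i v) (cvg_cst _))
  (@coord_continuous _ _ _ 0 j v)).
Qed.

Lemma continuous_rV_sum (R : realType) n :
  continuous (fun v : 'rV[R]_n.+1 => \sum_i v 0 i).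
Proof.
apply: continuous_big => [|i _ v]; first exact: add_continuous.
exact: coord_continuous.
Qed.

Lemma sqnorm_compact_section (R : realType) n :
  compact [set v : 'rV[R]_n.+1 | sqnorm v^T = 1 /\ \sum_i v 0 i = 0].
Proof.
apply: (@subclosed_compact _ _
  [set v : 'rV[R]_n.+1 | forall i, `[-1, 1]%classic (v 0 i)]).
- have -> : [set v : 'rV[R]_n.+1 | sqnorm v^T = 1 /\ \sum_i v 0 i = 0] =
    (fun v => bil 1%:M v^T v^T) @^-1` [set 1]
      `&` (fun v : 'rV[R]_n.+1 => \sum_i v 0 i) @^-1` [set 0].
    by apply/seteqP; split=> v /=; rewrite sqnorm_bil.
  apply: closedI.
    apply: preimage_closed => [v _|]; first exact: continuous_rV_quadratic.
    exact: closed_eq.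
  apply: preimage_closed => [v _|]; first exact: continuous_rV_sum.
  exact: closed_eq.
- have := @rV_compact _ n.+1 (fun=> `[-1, 1]%classic : set R)
    (fun=> @segment_compact R (-1) 1).
  by apply.
- move=> v [v1 _] i /=; rewrite in_itv/= -ler_norml.
  rewrite -(@ler_pXn2r _ 2)// ?nnegrE// expr1n real_normK ?num_real//.
  rewrite -v1 /sqnorm (bigD1 i)//= mxE lerDl.
  by apply: sumr_ge0 => j _; exact: sqr_ge0.
Qed.

(** The least value m of the form on the unit sphere of the complement of the
    constant vector is an eigenvalue of M. If m were 0, its eigenvector would be
    proportional to the constant vector, since the kernel is a line. *)
Lemma spectral_gap (R : realType) n (M : 'M[R]_n) (lam : R) :
  M^T = M -> M *m const_mx 1 = 0 :> 'cV[R]_n ->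
  \rank (eigenspace M 0) = 1%N ->
  (forall a, eigenvalue M a -> a != 0 -> lam <= a) ->
  forall w : 'cV[R]_n, \sum_i w i 0 = 0 -> lam * sqnorm w <= bil M w w.
Proof.
case: n M => [|n] M sM M1 rk gap w w0.
  by rewrite bilE /sqnorm !big_ord0 mulr0.
have [->|wn0] := eqVneq w 0.
  by rewrite sqnorm0 bil0 mulr0.
have sw : 0 < sqnorm w by rewrite sqnorm_gt0.
pose A := [set v : 'rV[R]_n.+1 | sqnorm v^T = 1 /\ \sum_i v 0 i = 0].
have normalize (z : 'cV[R]_n.+1) : 0 < sqnorm z -> \sum_i z i 0 = 0 ->
    A ((enorm z)^-1 *: z)^T.
  move=> z0 zs; split.
    by rewrite trmxK sqnormZ exprVn enorm_sqr mulVf// gt_eqF.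
  transitivity (\sum_i (enorm z)^-1 * z i 0).
    by apply: eq_bigr => i _; rewrite !mxE.
  by rewrite -mulr_sumr zs mulr0.
have [|||c] := @EVT_min_rV R n.+1 (fun v => bil M v^T v^T) A.
- by exists ((enorm w)^-1 *: w)^T; exact: normalize.
- exact: sqnorm_compact_section.
- apply: continuous_subspaceT => v; exact: continuous_rV_quadratic.
rewrite inE => -[c1 c0] cmin.
pose u := c^T; pose m := bil M u u.
have su : sqnorm u = 1 by [].
have u0 : \sum_i u i 0 = 0.
  by rewrite -[RHS]c0; apply: eq_bigr => i _; rewrite mxE.
have m_min (z : 'cV[R]_n.+1) : \sum_i z i 0 = 0 -> m * sqnorm z <= bil M z z.
  move=> zs; have [->|zn0] := eqVneq z 0.
    by rewrite sqnorm0 bil0 mulr0.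
  have sz : 0 < sqnorm z by rewrite sqnorm_gt0.
  have := cmin ((enorm z)^-1 *: z)^T; rewrite inE => /(_ (normalize z sz zs)).
  rewrite trmxK bilZl bilZr mulrA -expr2 exprVn enorm_sqr mulrC.
  by rewrite ler_pdivlMr.
(* m minimizes the Rayleigh quotient, so u is a critical point of the form
   M - m, which vanishes there; hence M u = m u. *)
have orth (z : 'cV[R]_n.+1) : \sum_i z i 0 = 0 -> bil (M - m%:M) u z = 0.
  move=> zs; set B := M - m%:M.
  have BE (p q : 'cV[R]_n.+1) : bil B p q = bil M p q - m * bil 1%:M p q.
    exact: bil_subscalar.
  have sB : B^T = B by rewrite /B linearB/= sM tr_scalar_mx.
  have B0 (p : 'cV[R]_n.+1) : \sum_i p i 0 = 0 -> 0 <= bil B p p.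
    by move=> ps; rewrite BE -sqnorm_bil subr_ge0; exact: m_min.
  have uu : bil B u u = 0 by rewrite BE -sqnorm_bil su mulr1 subrr.
  have poly a : 0 <= 2 * a * bil B u z + a ^+ 2 * bil B z z.
    have := B0 (u + a *: z); rewrite bilDl !bilDr !bilZl !bilZr (bilC z u sB) uu.
    rewrite (_ : \sum_i (u + a *: z) i 0 = 0); first by move=> /(_ erefl); lra.
    under eq_bigr do rewrite !mxE.
    rewrite big_split/= -mulr_sumr zs mulr0 addr0.
    by rewrite -[RHS]u0; apply: eq_bigr => i _; rewrite mxE.
  have zz := B0 z zs; set b := bil B u z in poly *; set d := bil B z z in poly zz.
  apply/eqP/negPn/negP => b0.
  have := poly (- b / (d + 1)).
  have d1 : 0 < d + 1 by rewrite ltr_wpDl.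
  rewrite (_ : _ + _ = - (b ^+ 2 * (d + 2)) / (d + 1) ^+ 2); last first.
    by field; rewrite gt_eqF.
  rewrite mulNr oppr_ge0 leNgt divr_gt0 ?exprn_gt0// mulr_gt0 ?ltr_wpDl//.
  by rewrite lt_neqAle eq_sym sqrf_eq0 b0 sqr_ge0.
have Mu : M *m u = m *: u.
  pose z := M *m u - m *: u.
  have zs : \sum_i z i 0 = 0.
    transitivity (\sum_i (M *m u) i 0 - m * \sum_i u i 0).
      rewrite mulr_sumr -sumrB; apply: eq_bigr => i _.
      by rewrite /z mxE [X in _ + X]mxE [X in - X]mxE.
    rewrite u0 mulr0 subr0.
    have : ((const_mx 1 : 'cV[R]_n.+1)^T *m (M *m u)) 0 0 = 0.
      by rewrite mulmxA -[_^T *m M]trmxK trmx_mul trmxK sM M1 trmx0 mul0mx mxE.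
    rewrite mxE => E; rewrite -[RHS]E; apply: eq_bigr => i _.
    by rewrite [X in _ = X * _]mxE [X in _ = X * _]mxE mul1r.
  apply/eqP; rewrite -subr_eq0 -/z -sqnorm_eq0; apply/eqP.
  rewrite -(orth z zs) sqnorm_bil [in RHS]/bil.
  have -> : u^T *m (M - m%:M) = z^T.
    rewrite /z -[LHS]trmxK trmx_mul trmxK linearB/= sM tr_scalar_mx.
    by rewrite mulmxBl mul_scalar_mx.
  by rewrite /bil mulmx1.
have lam_m : lam <= m.
  have uM : u^T *m M = m *: u^T.
    by rewrite -[LHS]trmxK trmx_mul trmxK sM Mu linearZ.
  have un0 : u^T != 0.
    apply/eqP => uz; move: su; rewrite -[u]trmxK uz trmx0 /sqnorm big1 => [/eqP|].
      by rewrite eq_sym oner_eq0.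
    by move=> i _; rewrite mxE expr0n.
  apply: gap; first by apply/eigenvalueP; exists u^T.
  apply/eqP => m0.
  have oneE : ((const_mx 1 : 'cV[R]_n.+1)^T <= eigenspace M 0)%MS.
    apply/eigenspaceP; rewrite scale0r.
    by rewrite -[LHS]trmxK trmx_mul trmxK sM M1 trmx0.
  have uE : (u^T <= eigenspace M 0)%MS by apply/eigenspaceP; rewrite uM m0.
  have one_rank : \rank ((const_mx 1 : 'cV[R]_n.+1)^T) = 1%N.
    rewrite rank_rV; case: eqP => // /matrixP/(_ 0 0).
    by rewrite !mxE => /eqP; rewrite oner_eq0.
  have : (u^T <= (const_mx 1 : 'cV[R]_n.+1)^T)%MS.
    apply: (submx_trans uE).
    by rewrite -(geq_leqif (mxrank_leqif_sup oneE)) rk one_rank.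
  move=> /sub_rVP[a ua].
  have uc i : u i 0 = a by rewrite -[u]trmxK ua !mxE mulr1.
  have : a *+ n.+1 = 0.
    rewrite -[RHS]u0 (eq_bigr (fun=> a)) => [|i _]; last exact: uc.
    by rewrite sumr_const card_ord.
  move=> /eqP; rewrite mulrn_eq0/= => /eqP a0.
  by move/eqP: un0; apply; rewrite ua a0 scale0r.
apply: le_trans (m_min w w0); by rewrite ler_pM2r.
Qed.

(** * The Laplacian and the stacked regressor *)

Lemma incidence_colsum (R : realType) n m (g : rel 'I_n) (D : 'M[R]_(n, m)) :
  oriented_incidence g D -> D^T *m const_mx 1 = 0 :> 'cV[R]_m.
Proof.
move=> [src [snk [_ _ DE]]]; apply/matrixP => k j; rewrite !mxE.
under eq_bigr do rewrite !mxE mulr1 DE.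
rewrite sumrB (bigD1 (src k))//= eqxx big1 => [|i /negbTE ->//].
by rewrite (bigD1 (snk k))//= eqxx big1 ?subrr// => i /negbTE ->.
Qed.

(** Exactly one column of D joins i and j when they are adjacent. This identifies the
    Laplacian with a matrix of fixed size whose entries are measurable in time,
    although the number of columns of D varies. *)
Lemma laplacian_offdiag (R : realType) n m (g : rel 'I_n) (D : 'M[R]_(n, m)) i j :
  simple_graph g -> oriented_incidence g D -> i != j ->
  laplacian D i j = - (g i j)%:R.
Proof.
move=> [gs gi] [src [snk [gE uniqE DE]]] ij.
have srcsnk k : src k != snk k.
  by apply/eqP => E; have := gE k; rewrite E gi.
pose P k := ((src k == i) && (snk k == j)) || ((src k == j) && (snk k == i)).
have term k : D i k * D j k = - (P k)%:R.
  rewrite !DE /P ![i == _]eq_sym ![j == _]eq_sym.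
  have := srcsnk k.
  have [->|si] := eqVneq (src k) i => /=.
    rewrite eq_sym (negbTE ij) /= => /negbTE ->.
    by case: eqP => _; rewrite /= ?sub0r ?subr0 ?mul1r ?mulr0 ?oppr0.
  have [->|sj] := eqVneq (src k) j => /=.
    move=> /negbTE; rewrite eq_sym => ->.
    by case: eqP => _; rewrite /= ?subr0 ?sub0r ?mulr1 ?mul0r ?oppr0.
  case: (eqVneq (snk k) i) => [->|_]; last by rewrite subr0 mul0r oppr0.
  by rewrite (negbTE ij) subr0 mulr0 oppr0.
rewrite mxE (eq_bigr (fun k => - (P k)%:R)) => [|k _]; last by rewrite mxE term.
rewrite sumrN; congr (- _).
have [gij|gij] := boolP (g i j); last first.
  rewrite big1// => k _; have [Pk|//] := boolP (P k); have := gE k.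
  by case/orP: Pk => /andP[/eqP -> /eqP ->]; rewrite ?(gs j i) (negbTE gij).
have [k [kP kU]] := uniqE i j gij.
have Pk : P k by apply/orP; case: kP => -[-> ->]; [left|right]; rewrite !eqxx.
rewrite (bigD1 k)//= Pk big1 ?addr0// => k' k'k.
have [Pk'|//] := boolP (P k').
have E : k = k'.
  by apply: kU; case/orP: Pk' => /andP[/eqP -> /eqP ->]; [left|right].
by rewrite E eqxx in k'k.
Qed.

Lemma laplacian_diag (R : realType) n m (g : rel 'I_n) (D : 'M[R]_(n, m)) i :
  oriented_incidence g D ->
  laplacian D i i = - \sum_(j | j != i) laplacian D i j.
Proof.
move=> /incidence_colsum D1.
have : (laplacian D *m const_mx 1) i (0 : 'I_1) = 0.
  by rewrite /laplacian -mulmxA D1 mulmx0 mxE.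
rewrite mxE (bigD1 i)//= [X in _ * X + _]mxE mulr1 => /eqP; rewrite addr_eq0 => /eqP ->.
by congr (- _); apply: eq_bigr => j _; rewrite [X in _ * X]mxE mulr1.
Qed.

Lemma laplacian_tr (R : realType) n m (D : 'M[R]_(n, m)) :
  (laplacian D)^T = laplacian D.
Proof. by rewrite /laplacian trmx_mul trmxK. Qed.

Definition agent (R : realType) n k (v : 'cV[R]_(n * k)) (i : 'I_n) : 'cV[R]_k :=
  \col_j v (mxtens_index (i, j)) 0.

(** The incidence matrix acts on these vectors: one coordinate, across all agents. *)
Definition component (R : realType) n k (v : 'cV[R]_(n * k)) (j : 'I_k) :
  'cV[R]_n := \col_i v (mxtens_index (i, j)) 0.

Lemma sum_tens (R : realType) n k (F : 'I_(n * k) -> R) :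
  \sum_l F l = \sum_i \sum_j F (mxtens_index (i, j)).
Proof.
rewrite pair_big/= (reindex (@mxtens_index n k))/=; last first.
  exists (@mxtens_unindex n k) => l _;
  [exact: mxtens_indexK|exact: mxtens_unindexK].
by apply: eq_bigr => -[].
Qed.

Lemma sqnorm_agents (R : realType) n k (v : 'cV[R]_(n * k)) :
  sqnorm v = \sum_i sqnorm (agent v i).
Proof.
rewrite /sqnorm sum_tens; apply: eq_bigr => i _; apply: eq_bigr => j _.
by rewrite mxE.
Qed.

Lemma sqnorm_components (R : realType) n k (v : 'cV[R]_(n * k)) :
  sqnorm v = \sum_j sqnorm (component v j).
Proof.
rewrite /sqnorm sum_tens exchange_big/=; apply: eq_bigr => j _.
by apply: eq_bigr => i _; rewrite mxE.
Qed.

Lemma agent_blockdiag (R : realType) n p q (A : 'I_n -> 'M[R]_(p, q))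
    (v : 'cV[R]_(n * q)) i :
  agent (blockdiag A *m v) i = A i *m agent v i.
Proof.
apply/matrixP => a o; rewrite !ord1 !mxE sum_tens (bigD1 i)//=.
rewrite [X in _ + X]big1 ?addr0 => [|j ji]; last first.
  rewrite big1// => b _; rewrite /blockdiag summxE big1 ?mul0r// => l _.
  rewrite tensmxE mxE; have [il|_] := eqVneq i l; last by rewrite mul0r.
  by rewrite -il (negbTE ji) mul0r.
apply: eq_bigr => b _; rewrite mxE; congr (_ * _).
rewrite /blockdiag summxE (bigD1 i)//= tensmxE mxE !eqxx mul1r big1 ?addr0// => l li.
by rewrite tensmxE mxE eq_sym (negbTE li) /= mul0r.
Qed.

Lemma component_tens1 (R : realType) n m k (B : 'M[R]_(m, n))
    (v : 'cV[R]_(n * k)) j :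
  component ((B *t (1%:M : 'M[R]_k)) *m v) j = B *m component v j.
Proof.
apply/matrixP => a o; rewrite !ord1 !mxE sum_tens; apply: eq_bigr => i _.
rewrite mxE (bigD1 j)//= big1 ?addr0 => [|b bj].
  by rewrite tensmxE mxE eqxx mulr1.
by rewrite tensmxE mxE eq_sym (negbTE bj) mulr0 mul0r.
Qed.

Lemma sqnorm_col_mx (R : realType) m k (u : 'cV[R]_m) (v : 'cV[R]_k) :
  sqnorm (col_mx u v) = sqnorm u + sqnorm v.
Proof.
rewrite /sqnorm big_split_ord/=.
by congr (_ + _); apply: eq_bigr => i _; rewrite ?col_mxEu ?col_mxEd.
Qed.

Lemma sqnorm_Lambda (R : realType) n m Ny k (alpha : R)
    (C : 'I_n -> 'M[R]_(Ny, k)) (D : 'M[R]_(n, m)) (v : 'cV[R]_(n * k)) :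
  0 <= alpha ->
  sqnorm (Lambda alpha C D *m v) =
  \sum_i sqnorm (C i *m agent v i)
  + alpha * \sum_j sqnorm (D^T *m component v j).
Proof.
move=> a0; rewrite /Lambda mul_col_mx sqnorm_col_mx sqnorm_agents.
congr (_ + _); first by apply: eq_bigr => i _; rewrite agent_blockdiag.
rewrite -scalemxAl sqnormZ sqr_sqrtr// sqnorm_components.
by congr (_ * _); apply: eq_bigr => j _; rewrite component_tens1.
Qed.

Lemma sqnorm_Lambda_le (R : realType) n m Ny k (alpha r2 r3 : R)
    (C : 'I_n -> 'M[R]_(Ny, k)) (D : 'M[R]_(n, m)) (v : 'cV[R]_(n * k)) :
  0 <= alpha -> (forall i, opnorm ((C i)^T *m C i) <= r2) ->
  opnorm (laplacian D) <= r3 ->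
  sqnorm (Lambda alpha C D *m v) <= r4 r2 r3 alpha * sqnorm v.
Proof.
move=> a0 Cb Db; rewrite sqnorm_Lambda// /r4 mulrDl; apply: lerD.
  rewrite (sqnorm_agents v) mulr_sumr; apply: ler_sum => i _.
  exact: sqnorm_mulmx_le.
rewrite -mulrA ler_wpM2l// (sqnorm_components v) mulr_sumr.
by apply: ler_sum => j _; apply: sqnorm_mulmx_le; rewrite trmxK.
Qed.

(** * Integrability of the Gram matrix *)

Lemma bil_delta (R : realType) k (A : 'M[R]_k) i j :
  bil A (delta_mx i 0) (delta_mx j 0) = A i j.
Proof.
rewrite bilE (bigD1 i)//= (bigD1 j)//= big1 => [|j' jj]; last first.
  by rewrite !mxE (negbTE jj) mulr0.
rewrite big1 => [|i' ii]; first by rewrite !mxE !eqxx mul1r mulr1 !addr0.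
by rewrite big1// => j' _; rewrite !mxE (negbTE ii) !mul0r.
Qed.

Lemma bil_entries_locint (R : realType) k (F : R -> 'M[R]_k) u v :
  (forall i j, locint (fun s => F s i j)) -> locint (fun s => bil (F s) u v).
Proof.
move=> Fi.
have H : locint (fun s => \sum_i \sum_j u i 0 * v j 0 * F s i j).
  by apply: locint_sum => i; apply: locint_sum => j; exact: locintZ.
apply: locint_eq H _ => s _; rewrite bilE.
by apply: eq_bigr => i _; apply: eq_bigr => j _; ring.
Qed.

Lemma bil_mxint (R : realType) k (F : R -> 'M[R]_k) u v a b :
  (forall i j, locint (fun s => F s i j)) -> 0 <= a ->
  bil (mxint `[a, b] F) u v =
  \int[lebesgue_measure]_(s in `[a, b]) bil (F s) u v.
Proof.
move=> Fi a0; transitivity (\int[lebesgue_measure]_(s in `[a, b])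
    \sum_i \sum_j u i 0 * v j 0 * F s i j); last first.
  apply: int_eq => s _; rewrite bilE.
  by apply: eq_bigr => i _; apply: eq_bigr => j _; ring.
have L i j : locint (fun s => u i 0 * v j 0 * F s i j) by exact: locintZ.
rewrite int_sum// => [|i]; last exact: locint_sum.
rewrite bilE; apply: eq_bigr => i _; rewrite int_sum//; apply: eq_bigr => j _.
by rewrite intZ// mxE; ring.
Qed.

(** Polarization recovers the entries from the values of the form. *)
Lemma entries_locint (R : realType) k (F : R -> 'M[R]_k) :
  (forall s, 0 <= s -> (F s)^T = F s) ->
  (forall v, locint (fun s => bil (F s) v v)) ->
  forall i j, locint (fun s => F s i j).
Proof.
move=> sF Fi i j; pose p : 'cV[R]_k := delta_mx i 0; pose q : 'cV[R]_k := delta_mx j 0.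
apply: locint_eq (locintZ 2^-1 (locintD (Fi (p + q))
  (locintD (locintN (Fi p)) (locintN (Fi q))))) _ => s s0.
rewrite bilDl !bilDr (bilC q p (sF s s0)) -[RHS]bil_delta -/p -/q.
by field.
Qed.

Lemma gram_entries_locint (R : realType) m k (C : R -> 'M[R]_(m, k)) (c : R) :
  (forall a b, measurable_fun (`[0, +oo[ : set R) (fun t => C t a b)) ->
  (forall t, 0 <= t -> opnorm ((C t)^T *m C t) <= c) ->
  forall a b, locint (fun t => ((C t)^T *m C t) a b).
Proof.
move=> mC Cc a b.
have entry t j l : 0 <= t -> C t l j ^+ 2 <= c.
  move=> t0; have := sqnorm_mulmx_le (delta_mx j 0) (Cc t t0).
  rewrite -colE; have -> : sqnorm (delta_mx j 0 : 'cV[R]_k) = 1.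
    by rewrite sqnorm_bil bil_delta mxE eqxx.
  rewrite mulr1; apply: le_trans; rewrite /sqnorm (bigD1 l)//= mxE lerDl.
  by apply: sumr_ge0 => i _; exact: sqr_ge0.
have H : locint (fun t => \sum_l C t l a * C t l b).
  apply: locint_sum => l; apply: locint_bounded.
    exact: measurable_funM.
  move=> d d0; exists c => t /andP[t0 _].
  rewrite ler_norml; have := entry t a l t0; have := entry t b l t0.
  have := sqr_ge0 (C t l a - C t l b); have := sqr_ge0 (C t l a + C t l b).
  by move=> *; apply/andP; split; lra.
apply: locint_eq H _ => t _; rewrite mxE.
by apply: eq_bigr => l _; rewrite mxE.
Qed.

Lemma laplacian_entries_locint (R : realType) n (ne : R -> nat)
    (G : R -> rel 'I_n) (D : forall t : R, 'M[R]_(n, ne t)) :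
  (forall t, 0 <= t -> simple_graph (G t)) ->
  (forall t, 0 <= t -> oriented_incidence (G t) (D t)) ->
  (forall i j, measurable_fun (`[0, +oo[ : set R) (fun t => G t i j)) ->
  forall i j, locint (fun t => laplacian (D t) i j).
Proof.
move=> Gs GD mG.
have off i j : i != j -> locint (fun t => laplacian (D t) i j).
  move=> ij.
  have H : locint (fun t => if G t i j then -1 else 0 : R).
    apply: locint_bounded; first by apply: measurable_fun_if => //.
    by move=> b b0; exists 1 => t _; case: ifP; rewrite ?normrN ?normr1 ?normr0.
  apply: locint_eq H _ => t t0.
  rewrite (laplacian_offdiag (Gs t t0) (GD t t0) ij).
  by case: (G t i j); rewrite ?oppr0.
move=> i j; have [<-|] := eqVneq i j; last exact: off.
have H : locint (fun t => \sum_l if l != i then laplacian (D t) i l else 0).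
  apply: locint_sum => l; have [->|li] := eqVneq l i; first exact: locint0.
  by apply: off; rewrite eq_sym.
apply: locint_eq (locintN H) _ => t t0.
by rewrite (laplacian_diag i (GD t t0)) -big_mkcond.
Qed.

Lemma bil_laplacian (R : realType) n m (D : 'M[R]_(n, m)) u :
  bil (laplacian D) u u = sqnorm (D^T *m u).
Proof. by rewrite sqnorm_bil -bil_gram trmxK. Qed.

Lemma Lambda_gram_entries_locint (R : realType) n Ny k (alpha : R) (ne : R -> nat)
    (C : 'I_n -> R -> 'M[R]_(Ny, k)) (D : forall t : R, 'M[R]_(n, ne t)) :
  0 <= alpha ->
  (forall i a b, locint (fun t => ((C i t)^T *m C i t) a b)) ->
  (forall i j, locint (fun t => laplacian (D t) i j)) ->
  forall i j, locint (fun t =>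
    ((Lambda alpha (C^~ t) (D t))^T *m Lambda alpha (C^~ t) (D t)) i j).
Proof.
move=> a0 Ci Li; apply: entries_locint => [s _|v]; first by rewrite trmx_mul trmxK.
have H : locint (fun t =>
    \sum_i bil ((C i t)^T *m C i t) (agent v i) (agent v i)
    + alpha * \sum_j bil (laplacian (D t)) (component v j) (component v j)).
  apply: locintD; last apply: locintZ; apply: locint_sum => i;
  exact: bil_entries_locint.
apply: locint_eq H _ => t _; rewrite bil_gram -sqnorm_bil sqnorm_Lambda//.
congr (_ + _ * _); apply: eq_bigr => i _; first by rewrite bil_gram -sqnorm_bil.
by rewrite bil_laplacian.
Qed.

(** * Persistent excitation of the network *)

Definition agents_mean (R : realType) n k (z : 'cV[R]_(n * k)) : 'cV[R]_k :=
  n%:R^-1 *: \sum_i agent z i.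

Lemma agents_deviation (R : realType) n k (z : 'cV[R]_(n * k)) : (0 < n)%N ->
  \sum_i sqnorm (agent z i - agents_mean z)
    = sqnorm z - n%:R * sqnorm (agents_mean z).
Proof.
move=> n0; set m := agents_mean z.
have nR : n%:R != 0 :> R by rewrite pnatr_eq0 -lt0n.
have mE : \sum_i bil 1%:M (agent z i) m = n%:R * sqnorm m.
  transitivity (bil 1%:M (\sum_i agent z i) m).
    rewrite /bil linear_sum/= !mulmx_suml summxE.
    by apply: eq_bigr => i _.
  by rewrite sqnorm_bil -bilZl /m /agents_mean scalerA mulfV// scale1r.
rewrite (eq_bigr (fun i => sqnorm (agent z i) - 2 * bil 1%:M (agent z i) m
   + sqnorm m)) => [|i _]; last by rewrite sqnormB.
rewrite big_split/= sumrB -mulr_sumr mE -sqnorm_agents sumr_const card_ord.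
by rewrite -mulr_natl; ring.
Qed.

(** The incidence matrices annihilate the mean of the agents, and the deviations from
    it lie in the complement of the constant vector, where the integrated
    Laplacian has a spectral gap. *)
Lemma disagreement_part (R : realType) n k (ne : R -> nat)
    (G : R -> rel 'I_n) (D : forall t : R, 'M[R]_(n, ne t))
    (lam t T : R) (z : 'cV[R]_(n * k)) :
  (0 < n)%N -> 0 <= t -> 0 <= T ->
  (forall t, 0 <= t -> oriented_incidence (G t) (D t)) ->
  (forall i j, locint (fun t => laplacian (D t) i j)) ->
  (let M := mxint `[t, t + T] (fun s => laplacian (D s)) in
     \rank (eigenspace M 0) = 1%N /\
     (forall a, eigenvalue M a -> a != 0 -> lam <= a)) ->
  lam * (sqnorm z - n%:R * sqnorm (agents_mean z)) <=
  \int[lebesgue_measure]_(s in `[t, t + T])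
    \sum_j sqnorm ((D s)^T *m component z j).
Proof.
move=> n0 t0 T0 GD Li; set M := mxint _ _ => /= -[rk gap].
have LE i j : M i j = \int[lebesgue_measure]_(s in `[t, t + T]) laplacian (D s) i j.
  by rewrite mxE.
have sM : M^T = M.
  apply/matrixP => i j; rewrite mxE !LE; apply: int_eq => s _.
  by rewrite -[in RHS]laplacian_tr [RHS]mxE.
have M1 : M *m const_mx 1 = 0 :> 'cV[R]_n.
  apply/matrixP => i j; rewrite !mxE.
  transitivity (\int[lebesgue_measure]_(s in `[t, t + T])
      \sum_j laplacian (D s) i j).
    rewrite int_sum//; apply: eq_bigr => l _; by rewrite LE mxE mulr1.
  rewrite (@int_eq _ _ (fun=> 0)) => [|s /andP[ts _]].
    by rewrite int_cst ?mul0r// lerDl.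
  have := incidence_colsum (GD s (le_trans t0 ts)).
  move=> /(congr1 (mulmx (D s))); rewrite mulmxA mulmx0 => /matrixP/(_ i 0).
  by rewrite !mxE => E; rewrite -[RHS]E; apply: eq_bigr => l _;
    rewrite [X in _ * X]mxE mulr1.
pose m := agents_mean z.
pose d (j : 'I_k) : 'cV[R]_n := \col_i (agent z i - m) j 0.
have dE j : component z j = d j + m j 0 *: const_mx 1.
  by apply/matrixP => i o; rewrite !mxE mulr1 subrK.
have nR : n%:R != 0 :> R by rewrite pnatr_eq0 -lt0n.
have d0 j : \sum_i d j i 0 = 0.
  transitivity (\sum_i agent z i j 0 - n%:R * m j 0).
    have -> : n%:R * m j 0 = \sum_(i < n) m j 0.
      by rewrite sumr_const card_ord mulr_natl.
    by rewrite -sumrB; apply: eq_bigr => i _; rewrite mxE [LHS]mxE [X in _ + X]mxE.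
  by rewrite /m /agents_mean [X in _ - _ * X]mxE summxE mulVKf// subrr.
have dn : \sum_j sqnorm (d j) = sqnorm z - n%:R * sqnorm m.
  rewrite -(agents_deviation z n0) exchange_big/=; apply: eq_bigr => i _.
  by apply: eq_bigr => j _; rewrite mxE.
rewrite -dn mulr_sumr.
have compi j : locint (fun s => bil (laplacian (D s)) (d j) (d j)).
  exact: bil_entries_locint.
rewrite (@int_eq _ _ (fun s => \sum_j bil (laplacian (D s)) (d j) (d j))).
  rewrite int_sum//; apply: ler_sum => j _.
  rewrite -bil_mxint//; exact: spectral_gap.
move=> s /andP[ts _]; apply: eq_bigr => j _; rewrite bil_laplacian dE.
by rewrite mulmxDr -scalemxAr (incidence_colsum (GD s (le_trans t0 ts))) scaler0 addr0.
Qed.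

(** The mean m is excited because the sum of the Gram matrices of all agents is.
    The deviations w_i enter through the cross terms (C_i m)(C_i w_i) only, as the
    squares |C_i w_i|^2 can be dropped. *)
Lemma consensus_part (R : realType) n Ny k (C : 'I_n -> R -> 'M[R]_(Ny, k))
    (r2 iota t T b : R) (z : 'cV[R]_(n * k)) :
  (0 < n)%N -> 0 <= t -> 0 <= T ->
  (forall i a b, locint (fun t => ((C i t)^T *m C i t) a b)) ->
  (forall s, 0 <= s -> forall i, opnorm ((C i s)^T *m C i s) <= r2) ->
  mxle iota%:M (mxint `[t, t + T] (fun s => \sum_i (C i s)^T *m C i s)) ->
  b = n%:R * sqnorm (agents_mean z) ->
   iota / n%:R * b - 2 * r2 * T * Num.sqrt (b * (sqnorm z - b)) <=
  \int[lebesgue_measure]_(s in `[t, t + T])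
    \sum_i sqnorm (C i s *m agent z i).
Proof.
move=> n0 t0 T0 Ci Cb Iot; set m := agents_mean z => bE.
have nR : 0 < n%:R :> R by rewrite ltr0n.
pose w i := agent z i - m.
have Gi a c : locint (fun s => (\sum_i (C i s)^T *m C i s) a c).
  have H : locint (fun s => \sum_i ((C i s)^T *m C i s) a c) by exact: locint_sum.
  by apply: locint_eq H _ => s _; rewrite summxE.
have cross s : 0 <= s -> - (2 * r2 * Num.sqrt (b * (sqnorm z - b)))
     <= 2 * \sum_i bil 1%:M (C i s *m m) (C i s *m w i).
  move=> s0; set P := \sum_i _.
  have wE : \sum_i sqnorm (w i) = sqnorm z - b by rewrite bE; exact: agents_deviation.
  have w0 : 0 <= sqnorm z - b.
    by rewrite -wE; apply: sumr_ge0 => i _; exact: sqnorm_ge0.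
  have b0 : 0 <= b by rewrite bE mulr_ge0 ?sqnorm_ge0.
  have r20 : 0 <= r2.
    by apply: le_trans (Cb s s0 (Ordinal n0)); exact: opnorm_ge0.
  have P2 : P ^+ 2 <= r2 ^+ 2 * (b * (sqnorm z - b)).
    apply: (@le_trans _ _
      ((\sum_i enorm (C i s *m m) * enorm (C i s *m w i)) ^+ 2)).
      rewrite -[leLHS]real_normK ?num_real//.
      rewrite ler_pXn2r// ?nnegrE//; last first.
        by apply: sumr_ge0 => i _; rewrite mulr_ge0 ?enorm_ge0.
      apply: (le_trans (ler_norm_sum _ _ _)); apply: ler_sum => i _.
      rewrite -(@ler_pXn2r _ 2) ?nnegrE ?mulr_ge0 ?enorm_ge0//.
      by rewrite real_normK ?num_real// exprMn !enorm_sqr cauchy_schwarz.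
    apply: (le_trans (sum_cauchy_schwarz _ _)).
    rewrite (_ : r2 ^+ 2 * _ = (r2 * b) * (r2 * (sqnorm z - b))); last by ring.
    apply: ler_pM.
    - by apply: sumr_ge0 => i _; exact: sqr_ge0.
    - by apply: sumr_ge0 => i _; exact: sqr_ge0.
    - apply: (@le_trans _ _ (\sum_(i < n) r2 * sqnorm m)).
        apply: ler_sum => i _; rewrite enorm_sqr.
        exact: sqnorm_mulmx_le (Cb s s0 i).
      by rewrite sumr_const card_ord -mulr_natl bE; lra.
    - rewrite -wE mulr_sumr; apply: ler_sum => i _; rewrite enorm_sqr.
      exact: sqnorm_mulmx_le (Cb s s0 i).
  have : `|P| <= r2 * Num.sqrt (b * (sqnorm z - b)).
    rewrite -(@ler_pXn2r _ 2) ?nnegrE ?mulr_ge0 ?sqrtr_ge0//.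
    by rewrite real_normK ?num_real// exprMn sqr_sqrtr ?mulr_ge0.
  by rewrite ler_norml => /andP[H _]; lra.
apply: (@le_trans _ _ (\int[lebesgue_measure]_(s in `[t, t + T])
   (bil (\sum_i (C i s)^T *m C i s) m m
    - 2 * r2 * Num.sqrt (b * (sqnorm z - b))))).
  rewrite intD//; [|exact: bil_entries_locint|exact: locint_cst].
  have tTt : t + T - t = T by rewrite addrC addKr.
  rewrite int_cst ?lerDl// tTt -bil_mxint//.
  apply: lerD; last by rewrite mulNr lerN2; lra.
  have := Iot m; rewrite -/(bil _ m m).
  rewrite bil_subscalar -sqnorm_bil.
  by rewrite subr_ge0 => H; apply: le_trans H; rewrite bE mulrA divfK ?gt_eqF.
apply: int_le => //.
- by apply: locintD; [exact: bil_entries_locint|exact: locint_cst].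
- have H : locint (fun s => \sum_i bil ((C i s)^T *m C i s) (agent z i) (agent z i)).
    by apply: locint_sum => i; exact: bil_entries_locint.
  by apply: locint_eq H _ => s _; apply: eq_bigr => i _; rewrite bil_gram -sqnorm_bil.
move=> s /andP[ts _]; have s0 := le_trans t0 ts.
have -> : bil (\sum_i (C i s)^T *m C i s) m m = \sum_i sqnorm (C i s *m m).
  rewrite /bil mulmx_sumr mulmx_suml summxE; apply: eq_bigr => i _.
  by rewrite -/(bil _ m m) bil_gram -sqnorm_bil.
apply: (le_trans (lerD (lexx _) (cross s s0))).
rewrite mulr_sumr -big_split/=; apply: ler_sum => i _.
have E : C i s *m agent z i = C i s *m m + C i s *m w i.
  by rewrite -mulmxDr /w [m + _]addrC subrK.
by rewrite E sqnormD lerDl sqnorm_ge0.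
Qed.

(** On the unit sphere, with a the mean scaled by sqrt n so that |a|^2 is the share of
    the consensus subspace, the two parts are bounded below by the two terms of
    the maximum in iota2_lo. *)
Lemma network_excitation (R : realType) n Ny k (C : 'I_n -> R -> 'M[R]_(Ny, k))
    (ne : R -> nat) (G : R -> rel 'I_n) (D : forall t : R, 'M[R]_(n, ne t))
    (alpha r2 iota lam t T : R) :
  (0 < n)%N -> 0 <= t -> 0 <= T -> 0 <= alpha -> 0 <= lam ->
  (forall i a b, locint (fun t => ((C i t)^T *m C i t) a b)) ->
  (forall i j, locint (fun t => laplacian (D t) i j)) ->
  (forall t, 0 <= t -> oriented_incidence (G t) (D t)) ->
  (forall s, 0 <= s -> forall i, opnorm ((C i s)^T *m C i s) <= r2) ->
  mxle iota%:M (mxint `[t, t + T] (fun s => \sum_i (C i s)^T *m C i s)) ->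
  (let M := mxint `[t, t + T] (fun s => laplacian (D s)) in
     \rank (eigenspace M 0) = 1%N /\
     (forall a, eigenvalue M a -> a != 0 -> lam <= a)) ->
  forall z, iota2_lo n k T r2 iota lam alpha * sqnorm z <=
    \int[lebesgue_measure]_(s in `[t, t + T])
      sqnorm (Lambda alpha (C^~ s) (D s) *m z).
Proof.
move=> n0 t0 T0 a0 l0 Ci Li GD Cb Iot gap z.
have nR : 0 < n%:R :> R by rewrite ltr0n.
have Cli (u : 'cV[R]_(n * k)) : locint (fun s => \sum_i sqnorm (C i s *m agent u i)).
  apply: locint_sum => i.
  apply: locint_eq (bil_entries_locint (agent u i) (agent u i) (Ci i)) _ => s _.
  by rewrite bil_gram -sqnorm_bil.
have Dli (u : 'cV[R]_(n * k)) :
    locint (fun s => \sum_j sqnorm ((D s)^T *m component u j)).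
  apply: locint_sum => j.
  apply: locint_eq (bil_entries_locint (component u j) (component u j) Li) _ => s _.
  exact: bil_laplacian.
have LE (u : 'cV[R]_(n * k)) :
  \int[lebesgue_measure]_(s in `[t, t + T]) sqnorm (Lambda alpha (C^~ s) (D s) *m u)
  = \int[lebesgue_measure]_(s in `[t, t + T]) (\sum_i sqnorm (C i s *m agent u i))
  + alpha * \int[lebesgue_measure]_(s in `[t, t + T])
      (\sum_j sqnorm ((D s)^T *m component u j)).
  rewrite -intZ// -intD//; last exact: locintZ.
  by apply: int_eq => s _; rewrite sqnorm_Lambda.
set l := iota2_lo _ _ _ _ _ _ _.
have unit_case (u : 'cV[R]_(n * k)) : sqnorm u = 1 -> l <=
    \int[lebesgue_measure]_(s in `[t, t + T])
      sqnorm (Lambda alpha (C^~ s) (D s) *m u).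
  move=> u1; rewrite LE.
  set c := \int[_]_(s in _) _; set d := \int[_]_(s in _) _.
  have c0 : 0 <= c.
    by apply: int_ge0 => // s _; apply: sumr_ge0 => i _; exact: sqnorm_ge0.
  have d0 : 0 <= d.
    by apply: int_ge0 => // s _; apply: sumr_ge0 => i _; exact: sqnorm_ge0.
  pose a : 'cV[R]_k := Num.sqrt n%:R *: agents_mean u.
  have aE : sqnorm a = n%:R * sqnorm (agents_mean u).
    by rewrite sqnormZ sqr_sqrtr// ltW.
  have cP := consensus_part n0 t0 T0 Ci Cb Iot aE.
  have dP := disagreement_part u n0 t0 T0 GD Li gap.
  rewrite -aE u1 -/d in dP; rewrite u1 -/c in cP.
  have a1 : sqnorm a <= 1.
    rewrite -u1 -subr_ge0 aE -agents_deviation//.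
    by apply: sumr_ge0 => i _; exact: sqnorm_ge0.
  apply: (@le_trans _ _ (Num.max (alpha * lam * (1 - sqnorm a))
    (iota / n%:R * sqnorm a - 2 * r2 * T * Num.sqrt (sqnorm a * (1 - sqnorm a))))).
    apply: ge_inf; last by exists a.
    exists 0 => _ [a' /= a'1 <-]; rewrite le_max; apply/orP; left.
    by rewrite !mulr_ge0// subr_ge0.
  rewrite ge_max; apply/andP; split.
    by apply: ler_wpDl => //; rewrite -mulrA ler_wpM2l.
  by apply: (le_trans cP); rewrite lerDl mulr_ge0.
have [->|z0] := eqVneq z 0.
  rewrite sqnorm0 mulr0.
  by apply: int_ge0 => // s _; exact: sqnorm_ge0.
have sz : 0 < sqnorm z by rewrite sqnorm_gt0.
have ez : 0 < enorm z by rewrite sqrtr_gt0.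
have := unit_case ((enorm z)^-1 *: z).
rewrite sqnormZ exprVn enorm_sqr mulVf ?gt_eqF// => /(_ erefl).
rewrite !LE => H.
have scale s : sqnorm (Lambda alpha (C^~ s) (D s) *m z) =
   sqnorm z * sqnorm (Lambda alpha (C^~ s) (D s) *m ((enorm z)^-1 *: z)).
  rewrite -scalemxAr sqnormZ exprVn enorm_sqr mulVKf// gt_eqF//.
rewrite mulrC -LE (@int_eq _ _ _ _ _ (fun s _ => scale s)) intZ//; last first.
  apply: locint_eq (locintD (Cli _) (locintZ alpha (Dli _))) _ => s _.
  by rewrite sqnorm_Lambda.
by rewrite ler_pM2l// LE.
Qed.

(** * The matrix inequalities *)

(** It suffices to test with a vector supported on the first block. *)
Lemma lmi_weight (R : realType) (m k p r : nat) (T i3lo i3hi r4 : R)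
    (Delta1 : 'M[R]_(k, r)) (Delta2 : 'M[R]_(m, r)) (Q : 'M[R]_(p, k))
    (W : 'M[R]_(p, r)) (c1 c2 gamma1 gamma2 gamma : R) :
  mxle (block_mx
    (Phi11 T i3lo i3hi r4 Delta1 Delta2 Q W c1 c2 gamma1 gamma)
    (Phi12 m p i3lo Delta1 c1 c2) (Phi12 m p i3lo Delta1 c1 c2)^T
    (- gamma2)%:M) 0 ->
  (0 < m)%N -> c2 * T <= c1.
Proof.
move=> lmi m0; pose y : 'cV[R]_m := const_mx 1.
have := mxle0_bil lmi (col_mx (col_mx y 0) 0).
rewrite quadratic_block /Phi11 quadratic_block.
rewrite !(mulmx0, trmx0, mul0mx, mx11_0, bil0, addr0) bil_scalar => H.
have y0 : 0 < sqnorm y by exact: sqnorm_ones_gt0.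
by move: H; rewrite pmulr_lle0// addrC subr_le0.
Qed.

(** The two free blocks of the test vector are the maximizers: W d for the third
    block and - (2 c1 / sqrt (c2 iota3)) / gamma2 Delta1 d for the last one. This
    amounts to taking the Schur complements. *)
Lemma lmi_disturbance (R : realType) (m k p r : nat) (T i3lo i3hi r4 : R)
    (Delta1 : 'M[R]_(k, r)) (Delta2 : 'M[R]_(m, r)) (Q : 'M[R]_(p, k))
    (W : 'M[R]_(p, r)) (c1 c2 gamma1 gamma2 gamma : R) :
  mxle (block_mx
    (Phi11 T i3lo i3hi r4 Delta1 Delta2 Q W c1 c2 gamma1 gamma)
    (Phi12 m p i3lo Delta1 c1 c2) (Phi12 m p i3lo Delta1 c1 c2)^T
    (- gamma2)%:M) 0 ->
  W^T *m W = 1%:M -> 0 < c2 * i3lo -> 0 < gamma2 ->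
  0 <= 8 * c2 * i3hi ^+ 2 / i3lo -> 0 <= 8 * c2 * i3hi ^+ 2 * r4 * gamma1 / i3lo ->
  forall d, sqnorm d + c1 * sqnorm (Delta2 *m d)
    + 4 * c1 ^+ 2 / (c2 * i3lo * gamma2) * sqnorm (Delta1 *m d)
    <= gamma * sqnorm d.
Proof.
move=> lmi WW c20 g20 E1 E2 d.
set b := 2 * c1 / Num.sqrt (c2 * i3lo).
pose xi := - (b / gamma2) *: (Delta1 *m d).
have Wd : sqnorm (W *m d) = sqnorm d.
  by rewrite sqnorm_bil -bil_gram WW -sqnorm_bil.
have := mxle0_bil lmi (col_mx (col_mx 0 (col_mx 0 (col_mx (W *m d) d))) xi).
rewrite quadratic_block cross_trmx /Phi11 /Phi12 !quadratic_block.
rewrite !(mulmx0, trmx0, mul0mx, mx11_0, bil0, addr0, add0r).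
rewrite !tr_col_mx !(trmx0, mul_row_col, mul0mx, mulmx0, add0r, addr0).
rewrite !bil_scalar Wd.
have -> : ((W *m d)^T *m W *m d) 0 0 = sqnorm d.
  by rewrite -Wd sqnorm_bil /bil mulmx1 mulmxA.
have -> : (d^T *m W^T *m (W *m d)) 0 0 = sqnorm d.
  by rewrite -Wd sqnorm_bil /bil mulmx1 trmx_mul.
have -> : (d^T *m (- (2 * c1 / Num.sqrt (c2 * i3lo)) *: Delta1^T) *m xi) 0 0
   = b ^+ 2 / gamma2 * sqnorm (Delta1 *m d).
  rewrite -/b /xi -!(scalemxAr, scalemxAl) scalerA -trmx_mul [LHS]mxE.
  by rewrite sqnorm_bil /bil mulmx1 !mulmxA; ring.
rewrite bil_subscalar bilDl_mx !bilZ_mx !bil_gram -!sqnorm_bil sqnormZ.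
have -> : 4 * c1 ^+ 2 / (c2 * i3lo * gamma2) = b ^+ 2 / gamma2.
  rewrite /b expr_div_n sqr_sqrtr ?(ltW c20)//.
  have [c20' g20'] : c2 * i3lo != 0 /\ gamma2 != 0 by rewrite !gt_eqF.
  by rewrite exprMn invfM -natrX; ring.
have -> : (- (b / gamma2)) ^+ 2 = b ^+ 2 / gamma2 / gamma2.
  by field; rewrite gt_eqF.
set D1 := sqnorm (Delta1 *m d); set D2 := sqnorm (Delta2 *m d).
have H1 : 0 <= 8 * c2 * i3hi ^+ 2 / i3lo * D1 by rewrite mulr_ge0 ?sqnorm_ge0.
have H2 : 0 <= 8 * c2 * i3hi ^+ 2 * r4 * gamma1 / i3lo * D2.
  by rewrite mulr_ge0 ?sqnorm_ge0.
have -> : - gamma2 * (b ^+ 2 / gamma2 / gamma2 * D1) = - (b ^+ 2 / gamma2 * D1).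
  by field; rewrite gt_eqF.
lra.
Qed.

(** The test vectors are (x, 0) and (x, Q x), the latter being the minimizer of the
    second block. *)
Lemma output_weight (R : realType) (k p : nat) (Q : 'M[R]_(p, k)) (c : R) :
  mxlt 0 (block_mx c%:M (- Q^T) (- Q) 1%:M) ->
  ((0 < k)%N -> 0 < c) /\ (forall x, sqnorm (Q *m x) <= c * sqnorm x).
Proof.
move=> H; have qf u v : bil (block_mx c%:M (- Q^T) (- Q) 1%:M)
    (col_mx u v) (col_mx u v) = c * sqnorm u - 2 * bil 1%:M (Q *m u) v + sqnorm v.
  rewrite quadratic_block !bil_scalar mul1r -linearN cross_trmx.
  rewrite (_ : (v^T *m - Q *m u) 0 0 = - bil 1%:M (Q *m u) v); first ring.
  rewrite (bilC _ _ (trmx1 _ _)) /bil mulmx1 mulmxN mulNmx mulmxA.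
  by rewrite mxE.
have pos v : v != 0 -> 0 < bil (block_mx c%:M (- Q^T) (- Q) 1%:M) v v.
  by move=> v0; have := H v v0; rewrite subr0.
split=> [k0|x].
  pose x : 'cV[R]_k := const_mx 1.
  have x0 : x != 0 by rewrite -sqnorm_gt0 sqnorm_ones_gt0.
  have := pos (col_mx x 0); rewrite qf sqnorm0 /bil mulmx0 mx11_0.
  rewrite mulr0 subr0 addr0 col_mx_eq0 (negbTE x0) /= => /(_ erefl).
  by rewrite pmulr_lgt0// sqnorm_gt0.
have [->|x0] := eqVneq x 0; first by rewrite mulmx0 !sqnorm0 mulr0.
have := pos (col_mx x (Q *m x)); rewrite qf col_mx_eq0 (negbTE x0) /=.
by rewrite -sqnorm_bil => /(_ erefl); lra.
Qed.

(** * Square-integrable signals and the inverse gain *)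

Lemma nonneg_axis_le (R : realType) (f : R -> R) b :
  (forall s, 0 <= s -> 0 <= f s) -> 0 <= b ->
  lebesgue_measure.-integrable `[0, +oo[ (EFin \o f) ->
  \int[lebesgue_measure]_(s in `[0, b]) f s
    <= \int[lebesgue_measure]_(s in `[0, +oo[) f s.
Proof.
move=> f0 b0 fi.
have sub : `[0, b]%classic `<=` (`[0, +oo[%classic : set R).
  by apply: subset_itvl; rewrite bnd_simp.
apply: fine_le.
- by apply: integrable_fin_num => //; exact: integrableS fi.
- exact: integrable_fin_num.
apply: ge0_subset_integral => //; first exact: measurable_int fi.
by move=> s /=; rewrite in_itv/= andbT lee_fin; exact: f0.
Qed.

Lemma integral_nonneg_axis_bounded (R : realType) (f : R -> R) (B : R) :
  locint f -> (forall s, 0 <= s -> 0 <= f s) ->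
  (forall b, 0 <= b -> \int[lebesgue_measure]_(s in `[0, b]) f s <= B) ->
  (\int[lebesgue_measure]_(s in `[0%R, +oo[) (f s)%:E <= B%:E)%E.
Proof.
move=> fi f0 fB; rewrite itv0y_bigcup0S.
have mono : {homo (fun n => `[0, n.+1%:R]%classic : set R) :
    n m / (n <= m)%N >-> (n <= m)%O}.
  move=> n m nm; apply/subsetPset; apply: subset_itvl.
  by rewrite bnd_simp ler_nat.
have nonneg n s : `[0, n.+1%:R]%classic s -> (0 <= (EFin \o f) s)%E.
  by rewrite /= in_itv/= => /andP[s0 _]; rewrite lee_fin f0.
have cvg_int := ge0_nondecreasing_set_cvg_integral (mu := lebesgue_measure)
  mono (fun n => measurable_itv _)
  (fun n => measurable_int _ (fi n.+1%:R (ler0n _ _))) nonneg.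
rewrite -(cvg_lim _ cvg_int)//; apply: lime_le.
  by apply/cvg_ex; eexists; exact: cvg_int.
apply: nearW => n; rewrite -[leLHS]fineK; first by rewrite lee_fin; exact: fB.
by apply: integrable_fin_num => //; exact: fi.
Qed.

Lemma sqnorm_locint (R : realType) k (u : R -> 'cV[R]_k) (g : R -> R) :
  vlocint u -> locint g -> (forall s, 0 <= s -> sqnorm (u s) <= g s) ->
  locint (fun s => sqnorm (u s)).
Proof.
move=> ui gi ug; apply: locint_le gi.
  apply: measurable_sum => i; apply: measurable_funX; exact: locint_measurable.
by move=> t t0; rewrite ger0_norm ?sqnorm_ge0// ug.
Qed.

Lemma L2_locint (R : realType) k (u : R -> 'cV[R]_k) : L2 u ->
  [/\ vlocint u, locint (fun s => sqnorm (u s))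
    & lebesgue_measure.-integrable `[0, +oo[ (fun s => (sqnorm (u s))%:E)].
Proof.
move=> [mu u2].
have ms : measurable_fun (`[0, +oo[%classic : set R) (fun s => sqnorm (u s)).
  by apply: measurable_sum => i; exact: measurable_funX.
have ui : lebesgue_measure.-integrable `[0, +oo[ (fun s => (sqnorm (u s))%:E).
  apply/integrableP; split; first exact/measurable_EFinP.
  under eq_integral do rewrite gee0_abs ?lee_fin ?sqnorm_ge0//.
  exact: u2.
have sl : locint (fun s => sqnorm (u s)).
  move=> t t0; apply: integrableS ui => //.
  by apply: subset_itvl; rewrite bnd_simp.
split=> // i; apply: locint_le (locintD (locint_cst 1) sl) => // t t0.
have : u t i 0 ^+ 2 <= sqnorm (u t).
  by rewrite /sqnorm (bigD1 i)//= lerDl; apply: sumr_ge0 => j _; exact: sqr_ge0.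
rewrite -[X in X <= _ -> _]real_normK ?num_real// => H.
have := sqr_ge0 (`|u t i 0| - 1); have := normr_ge0 (u t i 0); lra.
Qed.

Lemma blockdiag_tr (R : realType) n p q (A : 'I_n -> 'M[R]_(p, q)) :
  (blockdiag A)^T = blockdiag (fun i => (A i)^T).
Proof.
rewrite /blockdiag linear_sum/=; apply: eq_bigr => i _.
by rewrite trmx_tens trmx_delta.
Qed.

Lemma pos_def_unitmx (R : realType) k (A : 'M[R]_k) c : 0 < c ->
  (forall v, c * sqnorm v <= bil A v v) -> A \in unitmx.
Proof.
move=> c0 Ac; rewrite -row_free_unit; apply: inj_row_free => u uA.
have := Ac u^T; rewrite /bil trmxK uA mul0mx mx11_0 pmulr_rle0// => H.
have : sqnorm u^T == 0 by rewrite eq_le H sqnorm_ge0.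
by rewrite sqnorm_eq0 => /eqP u0; rewrite -[u]trmxK u0 trmx0.
Qed.

(** With u = A^-1 w, coercivity and Cauchy-Schwarz give c |u|^2 <= |u| |w|. *)
Lemma sqnorm_invmx_le (R : realType) k (A : 'M[R]_k) c w : 0 < c ->
  (forall v, c * sqnorm v <= bil A v v) ->
  c ^+ 2 * sqnorm (invmx A *m w) <= sqnorm w.
Proof.
move=> c0 Ac; have uA := pos_def_unitmx c0 Ac; set u := invmx A *m w.
have wE : w = A *m u by rewrite mulKVmx.
have [->|u0] := eqVneq (sqnorm u) 0; first by rewrite mulr0 sqnorm_ge0.
have up : 0 < sqnorm u by rewrite lt_neqAle eq_sym u0 sqnorm_ge0.
rewrite -(ler_pM2l up); apply: le_trans (cauchy_schwarz u w).
rewrite wE -bil_mxr mulrCA -expr2 -exprMn.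
rewrite ler_pXn2r ?nnegrE//; first by rewrite mulr_ge0// ltW.
by apply: le_trans (Ac u); rewrite mulr_ge0// ltW.
Qed.

Lemma bil_invmx (R : realType) k (A : 'M[R]_k) z : A \in unitmx ->
  bil (invmx A) z z = bil A (invmx A *m z) (invmx A *m z).
Proof.
by move=> uA; rewrite [RHS]bil_mxr mulKVmx// [LHS]bil_mxr (bilC _ _ (trmx1 _ _)).
Qed.

(** With z = A u, Cauchy-Schwarz for the form of A gives
    |z|^4 = (u . A z)^2 <= (u . A u) (z . A z), and z . A^-1 z = u . A u. The constant
    opnorm A is linear in A, which is what lets the state be absorbed later. *)
Lemma sqnorm_le_bil_invmx (R : realType) k (A : 'M[R]_k) c z : 0 < c ->
  A^T = A -> (forall v, c * sqnorm v <= bil A v v) ->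
  sqnorm z <= opnorm A * bil (invmx A) z z.
Proof.
move=> c0 sA Ac; have uA := pos_def_unitmx c0 Ac; set u := invmx A *m z.
have zE : z = A *m u by rewrite mulKVmx.
have A0 v : 0 <= bil A v v.
  by apply: le_trans (Ac v); rewrite mulr_ge0 ?sqnorm_ge0// ltW.
rewrite (bil_invmx z uA) -/u; have [->|z0] := eqVneq (sqnorm z) 0.
  by rewrite mulr_ge0 ?opnorm_ge0.
have zp : 0 < sqnorm z by rewrite lt_neqAle eq_sym z0 sqnorm_ge0.
rewrite -(ler_pM2l zp) -[leLHS]expr2.
have zz : sqnorm z = bil A u z.
  by rewrite sqnorm_bil {1}zE bil_mul sA -bil_mxr.
rewrite {1}zz; apply: (le_trans (psd_cauchy_schwarz _ _ sA A0)).
rewrite mulrC mulrA; apply: ler_wpM2r => //.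
by rewrite mulrC; exact: bil_le_opnorm.
Qed.

(** * The disturbed system *)

(** With e = L x - Delta2 delta the velocity is - Gam f - w, where f = L^T e and
    w = Delta1 delta. The identity 2 (L x) . e = |L x|^2 + |e|^2 - |Delta2 delta|^2
    makes x^T Gam^-1 x a storage function that dissipates both |L x|^2 and |f|^2 / rho,
    the two quantities that the window estimate needs. The latter is used in place of
    |e|^2 because f is a combination of the velocity and of delta, hence measurable,
    whereas Delta2 is an arbitrary function of time. For the same reason d is a
    locally integrable majorant of |Delta2 delta|^2. *)
Lemma disturbed_state_bound (R : realType) (k r : nat) (m : R -> nat)
    (Gam : 'M[R]_k) (L : forall t : R, 'M[R]_(m t, k)) (Delta1 : 'M[R]_(k, r))
    (Delta2 : forall t : R, 'M[R]_(m t, r)) (x0 : 'cV[R]_k)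
    (delta : R -> 'cV[R]_r) (x : R -> 'cV[R]_k) (d : R -> R) (T rho l c Y : R) :
  let l3 := iota3_lo (opnorm Gam) (T * rho) l in
  (0 < k)%N -> 0 < T -> 0 < rho -> 0 < c -> 0 <= l -> 0 < l3 ->
  Gam^T = Gam -> (forall v, c * sqnorm v <= bil Gam v v) ->
  (forall i j, locint (fun t => ((L t)^T *m L t) i j)) ->
  (forall t v, 0 <= t -> sqnorm (L t *m v) <= rho * sqnorm v) ->
  (forall t z, 0 <= t -> l * sqnorm z <=
     \int[lebesgue_measure]_(s in `[t, t + T]) sqnorm (L s *m z)) ->
  vlocint delta -> locint (fun s => sqnorm (delta s)) ->
  locint d -> (forall t, 0 <= t -> sqnorm (Delta2 t *m delta t) <= d t) ->
  (forall b, 0 <= b -> \int[lebesgue_measure]_(s in `[0, b])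
     (d s + 4 * T / (c ^+ 2 * l3) * sqnorm (Delta1 *m delta s)) <= Y) ->
  solution (fun t => - (Gam *m (L t)^T *m L t))
    (fun t => Gam *m (L t)^T *m Delta2 t - Delta1) x0 delta x ->
  [/\ vlocint x, locint (fun s => sqnorm (x s))
    & forall b, 0 <= b -> l3 * \int[lebesgue_measure]_(s in `[0, b]) sqnorm (x s)
        <= 2 * T * (bil (invmx Gam) x0 x0 + Y)].
Proof.
move=> l3 k0 T0 rho0 c0 l0 l30 sG Gc Li Lb Lex di d2i ddi ddP eY sol.
set r1 := opnorm Gam in l3 l30 eY *; set h := T * rho.
have uG := pos_def_unitmx c0 Gc.
pose Gi := invmx Gam.
have sGi : Gi^T = Gi by rewrite /Gi trmx_inv sG.
pose one : 'cV[R]_k := const_mx 1.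
have one0 : 0 < sqnorm one by exact: sqnorm_ones_gt0.
have cr : c <= r1.
  rewrite -(ler_pM2r one0); exact: le_trans (Gc one) (bil_le_opnorm _ _).
have r10 : 0 < r1 := lt_le_trans c0 cr.
have h0 : 0 < h by rewrite mulr_gt0.
have lh : l <= h.
  rewrite -(ler_pM2r one0); apply: (le_trans (Lex 0 one (lexx 0))).
  have -> : h * sqnorm one =
      \int[lebesgue_measure]_(s in `[0, 0 + T]) (rho * sqnorm one).
    by rewrite int_cst ?lerDl ?ltW// add0r subr0 /h; ring.
  apply: int_le => //.
  - apply: locint_eq (bil_entries_locint one one Li) _ => s _.
    by rewrite bil_gram -sqnorm_bil.
  - exact: locint_cst.
  - by move=> s /andP[s0 _]; exact: Lb.
have [S [q [[S0 q0 lp] [Sq l3E wq r1l3]]]] := iota3_lo_weights r10 l0 lh l30.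
rewrite -/l3 in l3E wq r1l3.
pose p := (r1 * h) ^+ 2 / (2 * S).
have p0 : 0 < p by rewrite divr_gt0 ?mulr_gt0 ?exprn_gt0 ?mulr_gt0.
pose f s := (L s)^T *m (L s *m x s - Delta2 s *m delta s).
pose w s := Delta1 *m delta s.
pose v s := - (Gam *m (L s)^T *m L s) *m x s +
            (Gam *m (L s)^T *m Delta2 s - Delta1) *m delta s.
have vE s : v s = - (Gam *m f s + w s).
  rewrite /v /f /w mulNmx mulmxBl !mulmxBr opprD opprB !mulmxA.
  by rewrite addrA; congr (_ - _); rewrite addrC.
have vi : vlocint v by move=> i t t0; have [H _] := sol t t0; exact: H.
have xP : primitive_of x0 v x by move=> t t0; have [_ ->] := sol t t0.
have xi := primitive_of_locint vi xP.
have wi : vlocint w by exact: vlocint_mulmx.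
have fE s : f s = - Gi *m (v s + w s).
  by rewrite vE opprD subrK mulNmx mulmxN opprK mulmxA mulVmx// mul1mx.
have fi : vlocint f.
  have fi' : vlocint (fun s => - Gi *m (v s + w s)) by exact/vlocint_mulmx/vlocintD.
  by move=> i; apply: locint_eq (fi' i) _ => s _; rewrite fE.
pose M s := (L s)^T *m L s.
have fineq s : 0 <= s ->
    bil (M s) (x s) (x s) + sqnorm (f s) / rho <= 2 * bil 1%:M (x s) (f s) + d s.
  move=> s0; pose e := L s *m x s - Delta2 s *m delta s.
  have fe : sqnorm (f s) <= rho * sqnorm e.
    by apply: sqnorm_trmx_mulmx_le; [exact: ltW|move=> z; exact: Lb].
  have : bil 1%:M (x s) (f s) = bil 1%:M (L s *m x s) e by rewrite bil_mul.
  have : sqnorm (Delta2 s *m delta s) = sqnorm (L s *m x s - e).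
    by rewrite /e opprB addrC subrK.
  rewrite sqnormB => E1 E2; have := ddP s s0.
  have : sqnorm (f s) / rho <= sqnorm e by rewrite ler_pdivrMr// mulrC.
  rewrite /M bil_gram -sqnorm_bil E2; lra.
have Mxi : locint (fun s => bil (M s) (x s) (x s)).
  apply: (bil_locint vi xP) => i j.
  apply: locint_eq (primitive_ofM_locint j vi xP (Li i j)) _ => s _.
  exact: mulrC.
have xfi := bil_cst_locint 1%:M vi xP fi.
have Mpsd s z : 0 <= bil (M s) z z by rewrite /M bil_gram -sqnorm_bil sqnorm_ge0.
have f2i : locint (fun s => sqnorm (f s)).
  apply: (sqnorm_locint fi (locintZ rho (locintD (locintZ 2 xfi) ddi))) => s s0.
  rewrite mulrC -ler_pdivrMr//; have := fineq s s0; have := Mpsd s (x s); lra.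
have w2i : locint (fun s => sqnorm (w s)).
  by apply: (sqnorm_locint wi (locintZ (opnorm Delta1 ^+ 2) d2i)) => s _;
  exact: sqnorm_mulmx_le_opnorm.
have Gf2 s : sqnorm (Gam *m f s) <= r1 ^+ 2 * sqnorm (f s).
  exact: sqnorm_mulmx_le_opnorm.
have Gfi : vlocint (fun s => Gam *m f s) by exact: vlocint_mulmx.
have Gf2i : locint (fun s => sqnorm (Gam *m f s)).
  exact: (sqnorm_locint Gfi (locintZ (r1 ^+ 2) f2i)).
pose K := T ^+ 2 / 2 * rho / (q * S).
have K0 : 0 < K by rewrite divr_gt0 ?mulr_gt0// divr_gt0 ?exprn_gt0.
pose H s := bil (M s) (x s) (x s) + (rho^-1 * sqnorm (f s) + K * sqnorm (w s)).
have Hi : locint H.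
  by apply: locintD => //; apply: locintD; exact: locintZ.
have win t : 0 <= t -> l3 * sqnorm (x t)
     <= \int[lebesgue_measure]_(s in `[t, t + T]) H s.
  move=> t0.
  rewrite l3E mulrAC ler_pdivrMr// [leRHS]mulrC -intZ//.
  have := @excitation_window _ _ M x0 (fun s => Gam *m f s) w v x rho l T S p q t
    T0 t0 (ltW rho0) S0 p0 q0 Sq Gfi wi Gf2i w2i (fun s _ => vE s) xP Li.
  move=> W; apply: (le_trans (W _ _ _)).
  - by move=> s _; rewrite /M trmx_mul trmxK.
  - by move=> s z s0; rewrite Mpsd /M bil_gram -sqnorm_bil Lb.
  - move=> z; apply: (le_trans (Lex t z t0)); apply: int_le => //.
    + apply: locint_eq (bil_entries_locint z z Li) _ => s _.
      by rewrite bil_gram -sqnorm_bil.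
    + exact: bil_entries_locint.
    + by move=> s _; rewrite /M bil_gram -sqnorm_bil.
  apply: int_le => //.
  - apply: locintD; first exact: locintZ.
    by apply: locintZ; apply: locintD; exact: locintZ.
  - exact: locintZ.
  move=> s _; rewrite /H [leRHS]mulrDr lerD2l.
  apply: (@le_trans _ _ (T ^+ 2 / 2 * rho * (p^-1 * (r1 ^+ 2 * sqnorm (f s))
     + q^-1 * sqnorm (w s)))).
    rewrite ler_pM2l ?mulr_gt0// ?divr_gt0 ?exprn_gt0// lerD2r ler_pM2l ?invr_gt0//.
  rewrite le_eqVlt; apply/orP; left; apply/eqP.
  rewrite /p /K /h; field; by rewrite !gt_eqF.
have cl3 : 0 < c ^+ 2 * l3 by rewrite mulr_gt0 ?exprn_gt0.
have KK : K + 2 * T / (c ^+ 2 * l3) <= 4 * T / (c ^+ 2 * l3).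
  have -> : 4 * T / (c ^+ 2 * l3) = 2 * T / (c ^+ 2 * l3) + 2 * T / (c ^+ 2 * l3).
    by rewrite -mulrDl; congr (_ / _); ring.
  rewrite lerD2r /K ler_pdivrMr ?mulr_gt0// [leRHS]mulrAC ler_pdivlMr//.
  have : c ^+ 2 * h * l3 <= 4 * (q * S).
    apply: le_trans wq; rewrite ler_pM2r// ler_pM2r//.
    by rewrite ler_pXn2r ?nnegrE ?(ltW c0) ?(ltW r10)//.
  rewrite -(@ler_pM2l _ (T / 2)) ?divr_gt0// /h; lra.
pose e s := d s + 4 * T / (c ^+ 2 * l3) * sqnorm (w s).
have ei : locint e by apply: locintD => //; exact: locintZ.
split=> //; first exact: primitive_of_sqnorm_locint vi xP.
apply: (@dissipation_state_bound _ _ x0 v x Gi H e T l3 r1 Y) => //.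
- by move=> z; exact: sqnorm_le_bil_invmx c0 sG Gc.
- move=> s s0; rewrite /H; apply: addr_ge0 => //.
  by rewrite addr_ge0// mulr_ge0 ?sqnorm_ge0 ?invr_ge0 ?ltW.
move=> s s0.
(* the multiple of |x|^2 that the dissipation inequality tolerates *)
pose eps := l3 / (2 * T).
have eps0 : 0 < eps by rewrite divr_gt0// mulr_gt0.
have vbil : bil Gi (x s) (v s) = - bil 1%:M (x s) (f s) - bil 1%:M (x s) (Gi *m w s).
  rewrite vE bil_mxr mulmxN mulmxDr mulmxA mulVmx// mul1mx opprD bilDr.
  by rewrite !bilNr.
have young : - 2 * bil 1%:M (x s) (Gi *m w s)
    <= eps * sqnorm (x s) + eps^-1 * sqnorm (Gi *m w s).
  have := sqnorm_ge0 (eps *: x s + Gi *m w s).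
  rewrite sqnormD sqnormZ bilZl -(@pmulr_rge0 _ eps^-1) ?invr_gt0//.
  have -> : eps^-1 * (eps ^+ 2 * sqnorm (x s) +
      2 * (eps * bil 1%:M (x s) (Gi *m w s)) + sqnorm (Gi *m w s)) =
      eps * sqnorm (x s) + 2 * bil 1%:M (x s) (Gi *m w s)
      + eps^-1 * sqnorm (Gi *m w s) by field; rewrite gt_eqF.
  lra.
have gw : eps^-1 * sqnorm (Gi *m w s) <= 2 * T / (c ^+ 2 * l3) * sqnorm (w s).
  have := sqnorm_invmx_le (w s) c0 Gc; rewrite -/Gi => gi.
  have -> : 2 * T / (c ^+ 2 * l3) * sqnorm (w s) =
            eps^-1 * (c ^- 2 * sqnorm (w s)).
    by rewrite /eps; field; rewrite !gt_eqF.
  by rewrite ler_pM2l ?invr_gt0// mulrC ler_pdivlMr ?exprn_gt0// mulrC.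
have Kw : (K + 2 * T / (c ^+ 2 * l3)) * sqnorm (w s)
    <= 4 * T / (c ^+ 2 * l3) * sqnorm (w s) by rewrite ler_wpM2r ?sqnorm_ge0.
have := fineq s s0; rewrite /H /e vbil -/eps [sqnorm (f s) / rho]mulrC.
move: young gw Kw; rewrite mulrDl; lra.
Qed.

(** * The gain bound *)

Lemma iota2_lo_ge0 (R : realType) n N (T r2 iota lam alpha : R) :
  0 <= alpha -> 0 <= lam -> 0 <= iota2_lo n N T r2 iota lam alpha.
Proof.
move=> a0 l0; apply: lb_le_inf.
  exists (Num.max (alpha * lam * (1 - sqnorm (0 : 'cV[R]_N)))
    (iota / n%:R * sqnorm (0 : 'cV[R]_N) - 2 * r2 * T *
      Num.sqrt (sqnorm (0 : 'cV[R]_N) * (1 - sqnorm (0 : 'cV[R]_N))))).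
  by exists 0 => //=; rewrite sqnorm0.
move=> _ [a /= a1 <-]; rewrite le_max; apply/orP; left.
by rewrite !mulr_ge0// subr_ge0.
Qed.

(** Without outputs the integrated Gram matrix would vanish. It follows that the first
    block of the matrix inequality is not empty. *)
Lemma outputs_gt0 (R : realType) n N Ny (C : 'I_n -> R -> 'M[R]_(Ny, N))
    (iota a b : R) : (0 < N)%N -> 0 < iota -> a <= b ->
  mxle iota%:M (mxint `[a, b] (fun s => \sum_i (C i s)^T *m C i s)) ->
  (0 < Ny)%N.
Proof.
move=> N0 i0 ab; case: Ny C => [|//] C.
have -> : mxint `[a, b] (fun s => \sum_i (C i s)^T *m C i s) = 0.
  apply/matrixP => i j; rewrite !mxE (@int_eq _ _ (fun=> 0)) => [|s _].
    by rewrite int_cst// mul0r.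
  by rewrite summxE big1// => l _; rewrite mxE big_ord0.
move=> H; pose one : 'cV[R]_N := const_mx 1.
have := mxle_scalar_l H one; rewrite /bil mulmx0 mul0mx mx11_0 pmulr_rle0//.
by rewrite leNgt sqnorm_ones_gt0.
Qed.

Theorem corollary3 (R : realType) (n N Ny p r : nat)
  (n_gt0 : (0 < n)%N) (N_gt0 : (0 < N)%N)
  (* communication graph, oriented incidence matrix, regressors *)
  (G : R -> rel 'I_n) (ne : R -> nat) (D : forall t : R, 'M[R]_(n, ne t))
  (C : 'I_n -> R -> 'M[R]_(Ny, N))
  (graphG : forall t, 0 <= t -> simple_graph (G t))
  (incD : forall t, 0 <= t -> oriented_incidence (G t) (D t))
  (measG : forall i j, measurable_fun (`[0, +oo[ : set R) (fun t => G t i j))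
  (measC : forall i a b, measurable_fun (`[0, +oo[ : set R) (fun t => C i t a b))
  (* gradient gain, disturbance and output matrices *)
  (Gam : 'I_n -> 'M[R]_N) (symGam : forall i, (Gam i)^T = Gam i)
  (Delta1 : 'M[R]_(N, r))
  (Delta2 : forall t : R, 'M[R]_(n * Ny + ne t * N, r))
  (Q : 'M[R]_(p, n * N)) (W : 'M[R]_(p, r))
  (WW : W^T *m W = 1%:M) (QW : Q^T *m W = 0)
  (* condition (i) *)
  (T iota1_hi iota1_lo : R) (T_gt0 : 0 < T)
  (iota1_gt0 : 0 < iota1_lo) (iota1_le : iota1_lo <= iota1_hi)
  (cond1 : forall t, T <= t ->
     let I := mxint `[t - T, t] (fun s => \sum_i (C i s)^T *m C i s) in
     mxle I iota1_hi%:M /\ mxle iota1_lo%:M I)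
  (* condition (ii) *)
  (r2 : R) (r2_gt0 : 0 < r2)
  (cond2 : forall t, 0 <= t -> forall i, opnorm ((C i t)^T *m C i t) <= r2)
  (* condition (iii) *)
  (lambda_lo r3 : R) (lambda_gt0 : 0 < lambda_lo) (r3_gt0 : 0 < r3)
  (cond3 : forall t, T <= t ->
     let M := mxint `[t - T, t] (fun s => laplacian (D s)) in
     \rank (eigenspace M 0) = 1%N /\
     (forall a, eigenvalue M a -> a != 0 -> lambda_lo <= a))
  (cond3' : forall t, 0 <= t -> opnorm (laplacian (D t)) <= r3)
  (* design *)
  (alpha c1 c2 gamma1 gamma2 gamma : R) :
  let Gambar := blockdiag Gam in
  let r1 := opnorm Gambar in
  let i3lo a := iota3_lo r1 (iota2_hi T r2 r3 a)
                  (iota2_lo n N T r2 iota1_lo lambda_lo a) in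
  let i3hi a := iota3_hi r1 (iota2_hi T r2 r3 a)
                  (iota2_lo n N T r2 iota1_lo lambda_lo a) in
  let Delta1bar := ones_tens n Delta1 in
  argmax_pos (fun a => i3lo a / i3hi a) alpha ->
  0 < c2 ->
  mxlt 0 (block_mx (c2 * i3lo alpha / 2)%:M (- Q^T) (- Q) 1%:M) ->
  sdp_feasible T (i3lo alpha) (i3hi alpha) (r4 r2 r3 alpha)
    Delta1bar Delta2 Q W c2 c1 gamma1 gamma2 gamma ->
  mxle Gambar (Num.sqrt gamma1)%:M -> mxle (Num.sqrt gamma2)%:M Gambar ->
  forall x0 : 'cV[R]_(n * N),
    (L2_gain (error_system Gambar (fun t => Lambda alpha (C^~ t) (D t))
                Delta1bar Delta2 Q W x0)
     <= (Num.sqrt gamma)%:E)%E.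
Proof.
move=> Gambar r1 i3lo i3hi Delta1bar [alpha0 _] c20 outW feas GamU GamL x0.
have [[c10 g10 g20] g0 g12 lmi] := feas.
have k0 : (0 < n * N)%N by rewrite muln_gt0 n_gt0.
set l3 := i3lo alpha in outW feas lmi *.
set l := iota2_lo n N T r2 iota1_lo lambda_lo alpha.
have [c2l30 Qx] := output_weight outW.
have l30 : 0 < l3.
  by have := c2l30 k0; rewrite pmulr_lgt0// pmulr_rgt0.
have rho0 : 0 < r4 r2 r3 alpha by rewrite addr_gt0// mulr_gt0.
pose L t := Lambda alpha (C^~ t) (D t).
have sG : Gambar^T = Gambar.
  by rewrite /Gambar blockdiag_tr; congr blockdiag; apply/boolp.funext.
pose c := Num.sqrt gamma2.
have c0 : 0 < c by rewrite sqrtr_gt0.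
have c2E : c ^+ 2 = gamma2 by rewrite sqr_sqrtr// ltW.
have Gc := mxle_scalar_l GamL.
have Ci i a b : locint (fun t => ((C i t)^T *m C i t) a b).
  by apply: (gram_entries_locint (c := r2)) => // t t0; exact: cond2.
have Li := laplacian_entries_locint graphG incD measG.
have LLi := Lambda_gram_entries_locint (ltW alpha0) Ci Li.
have Lb t v : 0 <= t -> sqnorm (L t *m v) <= r4 r2 r3 alpha * sqnorm v.
  move=> t0; apply: sqnorm_Lambda_le; [exact: ltW|exact: cond2|exact: cond3'].
have shift t : t + T - T = t by rewrite addrK.
have Tle t : 0 <= t -> T <= t + T by move=> t0; rewrite lerDr.
have Lex t z : 0 <= t -> l * sqnorm z <=
    \int[lebesgue_measure]_(s in `[t, t + T]) sqnorm (L s *m z).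
  move=> t0; apply: (network_excitation n_gt0 t0 (ltW T_gt0) (ltW alpha0)
    (ltW lambda_gt0) Ci Li incD cond2).
    by have [_] := cond1 _ (Tle t t0); rewrite shift.
  by have := cond3 _ (Tle t t0); rewrite shift.
have Ny0 : (0 < Ny)%N.
  have [_] := cond1 T (lexx T).
  by apply: outputs_gt0 => //; rewrite gerBl ltW.
have m0 : (0 < n * Ny + ne 0%R * N)%N by rewrite ltn_addr// muln_gt0 n_gt0.
have c2T := lmi_weight (lmi 0 (lexx 0)) m0.
have c2l3 : 0 < c2 * l3 by rewrite mulr_gt0.
(* beta |Delta1 delta|^2 is what the Schur complement in the last block costs *)
pose beta := 4 * c1 ^+ 2 / (c2 * l3 * gamma2).
have dist t v : 0 <= t -> sqnorm v + c1 * sqnorm (Delta2 t *m v)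
    + beta * sqnorm (Delta1bar *m v) <= gamma * sqnorm v.
  move=> t0; apply: (lmi_disturbance (lmi t t0)) => //.
  - by rewrite divr_ge0 ?(ltW l30)// mulr_ge0 ?sqr_ge0 ?mulr_ge0 ?(ltW c20).
  - rewrite divr_ge0 ?(ltW l30)// !mulr_ge0 ?sqr_ge0 ?(ltW c20) ?(ltW rho0)//.
    exact: ltW.
have g2l3 : 0 < gamma2 * l3 by rewrite mulr_gt0.
have c2T0 : 0 < c2 * T by rewrite mulr_gt0.
have Kbeta : c2 * T * (4 * T / (gamma2 * l3)) <= beta.
  have -> : c2 * T * (4 * T / (gamma2 * l3)) = 4 * (c2 * T) ^+ 2 / (c2 * l3 * gamma2).
    by field; rewrite !gt_eqF.
  rewrite ler_pM2r ?invr_gt0 ?mulr_gt0// ler_pM2l//.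
  by rewrite ler_pXn2r ?nnegrE// ltW.
set V0 := bil (invmx Gambar) x0 x0.
have V00 : 0 <= V0.
  rewrite /V0 (bil_invmx x0 (pos_def_unitmx c0 Gc)).
  by apply: le_trans (Gc _); rewrite mulr_ge0 ?sqnorm_ge0// ltW.
apply: ereal_inf_lbound; exists (Num.sqrt gamma) => //.
split; first exact: sqrtr_ge0.
exists (Num.sqrt (c2 * T * V0)); first exact: sqrtr_ge0.
move=> delta y dL2 [x sol yE].
have [di d2i dint] := L2_locint dL2.
pose w s := Delta1bar *m delta s.
(* by the matrix inequality, d majorizes |Delta2 delta|^2 *)
pose d s := c1^-1 * ((gamma - 1) * sqnorm (delta s) - beta * sqnorm (w s)).
have wi : vlocint w by exact: vlocint_mulmx.
have w2i : locint (fun s => sqnorm (w s)).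
  by apply: (sqnorm_locint wi (locintZ (opnorm Delta1bar ^+ 2) d2i)) => s _;
  exact: sqnorm_mulmx_le_opnorm.
have ddi : locint d.
  by apply: locintZ; apply: locintD; [exact: locintZ|exact/locintN/locintZ].
have ddP t : 0 <= t -> sqnorm (Delta2 t *m delta t) <= d t.
  move=> t0; rewrite /d ler_pdivlMl//; have := dist t (delta t) t0.
  by rewrite -/(w t); lra.
have excess t : 0 <= t -> 0 <= (gamma - 1) * sqnorm (delta t).
  move=> t0; have := ddP t t0; have := sqnorm_ge0 (Delta2 t *m delta t).
  move=> /le_trans/[apply]; rewrite /d pmulr_rge0 ?invr_gt0// subr_ge0.
  apply: le_trans; rewrite mulr_ge0 ?sqnorm_ge0// divr_ge0//.
    by rewrite mulr_ge0// sqr_ge0.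
  by rewrite ltW// mulr_gt0.
(* c2 T (d + 4 T / (gamma2 l3) |w|^2) is at most (gamma - 1) |delta|^2, as
   c2 T <= c1 *)
pose I := \int[lebesgue_measure]_(s in `[0, +oo[) sqnorm (delta s).
pose Y := (c2 * T)^-1 * ((gamma - 1) * I).
have excess_int b : 0 <= b -> \int[lebesgue_measure]_(s in `[0, b])
    ((gamma - 1) * sqnorm (delta s)) <= (gamma - 1) * I.
  move=> b0; rewrite /I -RintegralZl//; apply: nonneg_axis_le => //.
  exact: (integrableZl _ (gamma - 1) dint).
have eY b : 0 <= b -> \int[lebesgue_measure]_(s in `[0, b])
    (d s + 4 * T / (c ^+ 2 * l3) * sqnorm (w s)) <= Y.
  move=> b0; rewrite /Y ler_pdivlMl// -intZ//; last first.
    by apply: locintD => //; exact: locintZ.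
  apply: le_trans (excess_int b b0); apply: int_le => //.
  - by apply: locintZ; apply: locintD => //; exact: locintZ.
  - exact: locintZ.
  move=> s /andP[s0 _]; rewrite c2E mulrDr.
  have d0 : 0 <= d s by apply: le_trans (ddP s s0); exact: sqnorm_ge0.
  have : c2 * T * d s <= c1 * d s by rewrite ler_wpM2r.
  have -> : c1 * d s = (gamma - 1) * sqnorm (delta s) - beta * sqnorm (w s).
    by rewrite /d mulVKf// gt_eqF.
  have : c2 * T * (4 * T / (gamma2 * l3)) * sqnorm (w s) <= beta * sqnorm (w s).
    by rewrite ler_wpM2r ?sqnorm_ge0.
  by rewrite -mulrA; lra.
have [xi x2i Xb] := disturbed_state_bound k0 T_gt0 rho0 c0
  (iota2_lo_ge0 n N T r2 iota1_lo (ltW alpha0) (ltW lambda_gt0)) l30 sG Gc LLi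
  Lb Lex di d2i ddi ddP eY sol.
have y2E t : 0 <= t -> sqnorm (y t) = sqnorm (Q *m x t) + sqnorm (delta t).
  move=> t0; rewrite yE// sqnormD bil_mul -/(W *m _).
  have -> : Q^T *m (W *m delta t) = 0 by rewrite mulmxA QW mul0mx.
  rewrite /bil mulmx0 mx11_0 mulr0 addr0; congr (_ + _).
  by rewrite sqnorm_bil -bil_gram WW -sqnorm_bil.
have yi : vlocint y.
  have yi' : vlocint (fun t => Q *m x t + W *m delta t).
    by apply: vlocintD; exact: vlocint_mulmx.
  by move=> i; apply: locint_eq (yi' i) _ => t t0; rewrite yE.
have y2le t : 0 <= t -> sqnorm (y t) <=
    c2 * l3 / 2 * sqnorm (x t) + sqnorm (delta t).
  by move=> t0; rewrite y2E// lerD2r; exact: Qx.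
have boundi : locint (fun t => c2 * l3 / 2 * sqnorm (x t) + sqnorm (delta t)).
  by apply: locintD => //; exact: locintZ.
have y2i : locint (fun t => sqnorm (y t)) := sqnorm_locint yi boundi y2le.
have yb b : 0 <= b -> \int[lebesgue_measure]_(s in `[0, b]) sqnorm (y s)
    <= c2 * T * V0 + gamma * I.
  move=> b0; apply: (@le_trans _ _ (\int[lebesgue_measure]_(s in `[0, b])
      (c2 * l3 / 2 * sqnorm (x s) + sqnorm (delta s)))).
    by apply: int_le => // s /andP[s0 _]; exact: y2le.
  rewrite intD//; last exact: locintZ.
  rewrite intZ//; have := Xb b b0; rewrite -/V0.
  set X := \int[lebesgue_measure]_(s in `[0, b]) sqnorm (x s) => XV.
  have : c2 / 2 * (l3 * X) <= c2 / 2 * (2 * T * (V0 + Y)).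
    by rewrite ler_pM2l// divr_gt0.
  have -> : c2 / 2 * (2 * T * (V0 + Y)) = c2 * T * V0 + (gamma - 1) * I.
    by rewrite /Y; field; rewrite !gt_eqF.
  have : \int[lebesgue_measure]_(s in `[0, b]) sqnorm (delta s) <= I.
    by apply: nonneg_axis_le => // s _; exact: sqnorm_ge0.
  lra.
have y_le := integral_nonneg_axis_bounded y2i (fun s _ => sqnorm_ge0 (y s)) yb.
split.
  split; last exact: le_lt_trans y_le (ltry _).
  by move=> i; exact: locint_measurable.
have I0 : 0 <= I by apply: Rintegral_ge0 => s _; exact: sqnorm_ge0.
have fin : \int[lebesgue_measure]_(s in `[0, +oo[) sqnorm (y s)
    <= c2 * T * V0 + gamma * I.
  rewrite -lee_fin /Rintegral fineK// ge0_fin_numE.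
    exact: le_lt_trans y_le (ltry _).
  by apply: integral_ge0 => s _; rewrite lee_fin sqnorm_ge0.
have A0 : 0 <= c2 * T * V0 by rewrite mulr_ge0// ltW.
have B0 : 0 <= gamma * I by rewrite mulr_ge0// ltW.
rewrite /L2norm -/I -sqrtrM ?(ltW g0)//.
apply: (le_trans (ler_wsqrtr fin)).
rewrite -(@ler_pXn2r _ 2) ?nnegrE ?addr_ge0 ?sqrtr_ge0//.
rewrite sqrrD !sqr_sqrtr ?addr_ge0//.
have : 0 <= Num.sqrt (gamma * I) * Num.sqrt (c2 * T * V0).
  by rewrite mulr_ge0 ?sqrtr_ge0.
lra.
Qed.
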